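(* Let $(z_1,\ldots,z_n,s,\theta)$ be coordinates on $\mathbb{C}^n\times\mathbb{R}\times\mathbb{S}^1=\mathbb{R}^{2n+1}\times\mathbb{S}^1$, with $z_i=r_ie^{i\varphi_i}$, and let $\xi$ be the tight contact structure on $V:=\mathbb{S}^{2n}\times\mathbb{S}^1$ defined by (the kernel of) the restriction of $\lambda=s\,d\theta+\frac12\sum_{i=1}^n r_i^2\,d\varphi_i$ on $\mathbb{R}^{2n+1}\times\mathbb{S}^1$ to $\mathbb{S}^{2n}\times\mathbb{S}^1=\{s^2+\sum_{i=1}^n|z_i|^2=1\}$. Let $\Psi$ be the diffeomorphism of $\mathbb{S}^{2n}\times\mathbb{S}^1$ given by the restriction of $$\mathbb{R}^{2n+1}\times\mathbb{S}^1\to\mathbb{R}^{2n+1}\times\mathbb{S}^1,\qquad (z_1,\ldots,z_n,s,\theta)\mapsto(z_1,\ldots,z_{n-1},e^{i\theta}z_n,s,\theta).$$ Then $\Psi$ is smoothly isotopic to a contactomorphism $\Psi_c$ of $(V,\xi)$ such that $[\Psi_c^2]$ generates an infinite cyclic subgroup of $\ker\bigl(\pi_0\,\mathrm{Diff}(V,\xi)\to\pi_0\,\mathrm{Diff}(V)\bigr)$.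
   Context: $\mathrm{Diff}(V)$ is the group of diffeomorphisms of $V$ and $\mathrm{Diff}(V,\xi)$ is the subgroup of contactomorphisms of $(V,\xi)$, i.e. diffeomorphisms $f$ with $f_*\xi=\xi$; the map on $\pi_0$ is induced by the inclusion. Here $\theta\in\mathbb{S}^1=\mathbb{R}/2\pi\mathbb{Z}$. ''Tight'' means not overtwisted in the sense of Borman–Eliashberg–Murphy (which in dimension 3 is Eliashberg's notion). *)

(* Defs.v *)
From HB Require Import structures.
From mathcomp Require Import all_boot all_order all_algebra.
From mathcomp Require Import ring.
From mathcomp Require Import all_classical all_reals all_analysis.

Set Implicit Arguments.
Unset Strict Implicit.
Unset Printing Implicit Defensive.

Import Order.TTheory GRing.Theory Num.Theory.
Import numFieldNormedType.Exports.

Local Open Scope classical_set_scope.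
Local Open Scope ring_scope.

Section Smooth.
Context {R : realType}.

(* f is C^(k+1) on the open set U iff it is differentiable on U and its tangent
   map Tf : (x, v) |-> (f x, df_x v) is C^k on U x E = TU. For the
   finite-dimensional E used below this is the usual notion. *)
Fixpoint Ck (k : nat) {E F : normedModType R} (U : set E) (f : E -> F)
    {struct k} : Prop :=
  match k with
  | 0 => forall x, U x -> {for x, continuous f}
  | k'.+1 => (forall x, U x -> differentiable f x) /\
      @Ck k' (E * E)%type (F * F)%type (U `*` setT)
        (fun p => (f p.1, 'd f (p.1) (p.2)))
  end.

Definition Cinf {E F : normedModType R} (U : set E) (f : E -> F) : Prop :=
  forall k, Ck k U f.

(* T is regarded as the subset i(T) of E, and g is smooth when it extends, near
   every point of i(T), to a smooth map on an open subset of E. *)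
Definition smooth {T : Type} {E F : normedModType R} (i : T -> E) (g : T -> F)
    : Prop :=
  forall t, exists (U : set E) (G : E -> F),
    [/\ open U, U (i t), Cinf U G & forall s, U (i s) -> G (i s) = g s].

End Smooth.

(* C^n x R x C = R^(2n+1) x R^2. The circle R/2piZ is realised as the unit
   circle of the last factor by theta |-> e^(i theta) = ca + i cb; the first
   factor has coordinates z_j = zx_j + i zy_j and s. *)
Definition amb (R : realType) (n : nat) : normedModType R :=
  (('rV[R]_n * 'rV[R]_n * R) * (R * R))%type.

Section Coordinates.
Variables (R : realType) (n : nat).
Implicit Type p : amb R n.

Definition zx p (j : 'I_n) : R := p.1.1.1 0 j.
Definition zy p (j : 'I_n) : R := p.1.1.2 0 j.
Definition sc p : R := p.1.2.
Definition ca p : R := p.2.1.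
Definition cb p : R := p.2.2.

(* S^(2n) x S^1 *)
Definition V : set (amb R n) := [set p |
  sc p ^+ 2 + \sum_(j < n) (zx p j ^+ 2 + zy p j ^+ 2) = 1 /\
  ca p ^+ 2 + cb p ^+ 2 = 1].

(* lambda_p(v), using d theta = ca dcb - cb dca on the unit circle and
   r^2 d phi = zx dzy - zy dzx. *)
Definition lambda (p v : amb R n) : R :=
  sc p * (ca p * cb v - cb p * ca v) +
  2^-1 * \sum_(j < n) (zx p j * zy v j - zy p j * zx v j).

(* (z_1, ..., z_n, s, theta) |-> (z_1, ..., z_(n-1), e^(i theta) z_n, s, theta);
   indices start at 0, so that z_n is the coordinate with j.+1 == n. *)
Definition Psi_amb (p : amb R n) : amb R n :=
  ((\row_j (if j.+1 == n then ca p * zx p j - cb p * zy p j else zx p j),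
    \row_j (if j.+1 == n then cb p * zx p j + ca p * zy p j else zy p j),
    sc p), (ca p, cb p)).

Lemma Psi_ambV p : V p -> V (Psi_amb p).
Proof.
move=> [Vp1 Vp2]; split=> //; rewrite -[RHS]Vp1; congr (_ + _).
apply: eq_bigr => j _; rewrite /zx /zy /= !mxE; case: ifP => // _.
rewrite -/(zx p j) -/(zy p j).
transitivity ((ca p ^+ 2 + cb p ^+ 2) * (zx p j ^+ 2 + zy p j ^+ 2)).
  by ring.
by rewrite Vp2 mul1r.
Qed.

Definition Psi (p : V) : V := SigSub (mem_set (Psi_ambV (set_valP p))).

End Coordinates.
Arguments V : clear implicits.

Section Contact.
Context {R : realType} {n : nat}.
Local Notation V := (V R n).
Implicit Types (f g : V -> V) (p : V) (v w : amb R n).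

Definition has_velocity (c : R -> V) p v : Prop :=
  c 0 = p /\ is_derive (0 : R) (1 : R) (fun t => val (c t)) v.

Definition tangent p : set (amb R n) := [set v | exists c, has_velocity c p v].

(* the graph of df_p : T_pV -> T_(f p)V *)
Definition tangent_map f p v w : Prop :=
  exists c, has_velocity c p v /\ has_velocity (f \o c) (f p) w.

Definition xi p : set (amb R n) := [set v | tangent p v /\ lambda (val p) v = 0].

Definition smooth_map f : Prop :=
  smooth (fun p => val p : amb R n) (fun p => val (f p) : amb R n).

Definition Diff : set (V -> V) := [set f : V -> V |
  smooth_map f /\ exists g, [/\ smooth_map g, cancel f g & cancel g f]].

(* f_* xi = xi *)
Definition Diff_xi : set (V -> V) := [set f : V -> V | Diff f /\
  forall p, [set w | exists2 v, xi p v & tangent_map f p v w] = xi (f p)].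

(* A smooth path in G from f to g. The times outside [0, 1] play no role. *)
Definition isotopic (G : set (V -> V)) f g : Prop :=
  exists H : R -> V -> V,
    [/\ smooth (fun tp : `[0, 1]%classic * V =>
                  (val tp.1, val tp.2) : (R * amb R n)%type)
               (fun tp => val (H (val tp.1) tp.2)),
        forall t : R, 0 <= t <= 1 -> G (H t),
        H 0 = f & H 1 = g].

(* The elements of pi_0(G), for G = Diff or Diff_xi, are the isotopy classes
   pi0_class G f with f in G; the group law is [f][g] = [f \o g], so that
   [f]^k = pi0_class G (zpow f k). *)
Definition pi0_class (G : set (V -> V)) f : set (V -> V) :=
  [set g | isotopic G f g].

Definition pi0 (G : set (V -> V)) : set (set (V -> V)) := pi0_class G @` G.

(* the map pi_0(G') -> pi_0(G) induced by an inclusion G' <= G *)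
Definition pi0_incl (G : set (V -> V)) (c : set (V -> V)) : set (V -> V) :=
  \bigcup_(f in c) pi0_class G f.

Definition ker_pi0_incl : set (set (V -> V)) :=
  [set c | pi0 Diff_xi c /\ pi0_incl Diff c = pi0_class Diff id].

(* the inverse of a bijection *)
Definition inv_map f : V -> V := fun q => xget q [set p | f p = q].

Definition zpow f (k : int) : V -> V :=
  match k with
  | Posz m => iter m f
  | Negz m => iter m.+1 (inv_map f)
  end.

Definition pi0_zpow (G : set (V -> V)) f (k : int) : set (V -> V) :=
  pi0_class G (zpow f k).

(* the subgroup of pi_0(G) generated by [f] *)
Definition pi0_cycle (G : set (V -> V)) f : set (set (V -> V)) :=
  range (pi0_zpow G f).

(* [f] generates an infinite cyclic group: k |-> [f]^k is an isomorphism from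
   the integers onto pi0_cycle G f *)
Definition infinite_cyclic (G : set (V -> V)) f : Prop :=
  injective (pi0_zpow G f).

End Contact.

(* Main.v *)
(* On [C^n x R minus 0] times the circle, the shear
   (z, s, theta) |-> (.., e^(i theta) z_n, s - |z_n|^2 / 2, theta) preserves
   lambda, and lambda is homogeneous of degree 1 for (z, s) |-> (sqrt c z, c s);
   normalising back to V yields an explicit contactomorphism Psi_c isotopic to
   Psi.  The belt trick makes Psi^2 smoothly isotopic to the identity.

   For a contactomorphism f, follow the loop {pole} x S^1 at z = 0, s = 1.  The
   differential of f on the contact planes, written in the global coordinates
   (z, s + i theta) of the symplectization and completed by the Liouville and
   Reeb-like directions, is conformally symplectic, so its complex linear part
   is invertible, and the determinant of that part is a loop in C minus 0.  Its
   winding number is constant along contact isotopies, and equals 2 k for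
   Psi_c^(2 k).  Symplecticity comes from differentiating the identity
   lambda (df u) = 0 on the contact planes once more. *)
Require Import Defs.
From HB Require Import structures.
From mathcomp Require Import all_boot all_order all_algebra.
From mathcomp Require Import ring lra.
From mathcomp Require Import all_classical all_reals all_analysis.
From mathcomp Require Import complex.

Set Implicit Arguments.
Unset Strict Implicit.
Unset Printing Implicit Defensive.

Import Order.TTheory GRing.Theory Num.Theory.
Import numFieldNormedType.Exports.

Local Open Scope classical_set_scope.
Local Open Scope ring_scope.

(** * Calculus of C^k maps *)

(** Over each point of the circle [Psi] rotates the sphere, so it is a loop in SO(2n+1), whose
    fundamental group has order 2; this is why the square dies smoothly. Along the pole a contact
    differential is, up to homotopy, a loop in U(n), and there the determinant counts all the turns.

    The obstacle is that a contact isotopy moves the pole, so differentials at different times land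
    in different contact planes. Placing these in the flat C^(n+1) gives all of them one
    trivialisation, at the price of one more complex row to make the matrix square. Invertibility
    requires a positive conformal factor: it never vanishes and equals 1 at the start of the
    isotopies considered.

    The invariant is not shown to be a homomorphism. Powers of [Psi_c] fix the pole circle
    pointwise, so their differentials compose there and the determinant is computed directly. Nor is
    a winding number defined as an integer: loops are only compared with each other. *)

Lemma continuous_near_eq (X Y : topologicalType) (f g : X -> Y) x :
  (\forall z \near x, f z = g z) ->
  {for x, continuous f} -> {for x, continuous g}.
Proof.
move=> fg cf; change (g @ x --> g x); rewrite -(nbhs_singleton fg).
by apply: cvg_trans cf; exact: near_eq_cvg.
Qed.

Lemma continuous_pair (A B C : topologicalType) (f : A -> B) (g : A -> C) x :
  {for x, continuous f} -> {for x, continuous g} ->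
  {for x, continuous (fun y => (f y, g y))}.
Proof. by move=> cf cg; apply: cvg_pair; [exact: cf|exact: cg]. Qed.

Section CkTheory.
Context {R : realType}.
Implicit Types E F G : normedModType R.

Lemma open_preimage_on {E F : topologicalType} (U : set E) (W : set F)
    (f : E -> F) :
  open U -> (forall x, U x -> {for x, continuous f}) -> open W ->
  open (U `&` f @^-1` W).
Proof.
move=> oU cf oW; rewrite openE => x [Ux Wx] /=.
apply: filterI; first exact: open_nbhs_nbhs.
by apply: cf => //; exact: open_nbhs_nbhs.
Qed.

Lemma open_setMT E F (U : set E) : open U -> open (U `*` [set: F]).
Proof.
move=> oU; have -> : U `*` [set: F] = fst @^-1` U.
  by apply/seteqP; split=> [[x y] []|[x y]].
by apply: open_comp => // x _; exact: cvg_fst.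
Qed.

Lemma Ck_continuous k E F (U : set E) (f : E -> F) x :
  Ck k U f -> U x -> {for x, continuous f}.
Proof.
case: k => [|k] /=; first by move=> h /h.
by move=> [h _] /h; exact: differentiable_continuous.
Qed.

Lemma Ck_sub k E F (U W : set E) (f : E -> F) :
  W `<=` U -> Ck k U f -> Ck k W f.
Proof.
elim: k E F U W f => [|k IH] E F U W f WU /= => [h x /WU/h //|[h1 h2]].
split; first by move=> x /WU/h1.
by apply: IH h2 => p [/= /WU ? _].
Qed.

(** The first-order expansion of [f] at [x] is also one of [g], and uniqueness of the differential
    gives both claims at once. *)
Lemma diff_near_eq E F (f g : E -> F) x : (\forall y \near x, f y = g y) ->
  differentiable f x -> differentiable g x /\ 'd g x = 'd f x :> (E -> F).
Proof.
move=> fg /diff_locallyP [cd Hd].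
have e : g \o shift x = cst (g x) + 'd f x +o_ (0 : E) id.
  have fgx : f x = g x by exact: nbhs_singleton fg.
  rewrite -fgx; apply/eqaddoP => eps e0.
  move/eqaddoP : Hd => /(_ eps e0) Hd.
  have : \forall y \near (0 : E), f (y + x) = g (y + x).
    by move: fg; rewrite (near_shift 0 x) subr0.
  move: Hd; apply: filterS2 => y + e2.
  by rewrite /= !fctE /= e2.
have dgE := diff_unique cd e; split; last by [].
by apply/diff_locallyP; rewrite dgE.
Qed.

Lemma Ck_eq k E F (U : set E) (f g : E -> F) : open U ->
  (forall x, U x -> f x = g x) -> Ck k U f -> Ck k U g.
Proof.
elim: k E F U f g => [|k IH] E F U f g oU fg /=.
  move=> h x Ux; apply: continuous_near_eq (h x Ux).
  by near=> y; apply: fg; near: y; exact: open_nbhs_nbhs.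
move=> [h1 h2].
have dg x : U x -> differentiable g x /\ 'd g x = 'd f x :> (E -> F).
  move=> Ux; apply: diff_near_eq (h1 x Ux).
  by near=> y; apply: fg; near: y; exact: open_nbhs_nbhs.
split; first by move=> x /dg[].
apply: IH h2; first exact: open_setMT.
by move=> [x v] [/= Ux _]; rewrite fg// (dg x Ux).2.
Unshelve. all: by end_near. Qed.

Definition clin E F (f : E -> F) := linear f /\ continuous f.

Lemma clin_diff E F (f : E -> F) x : clin f ->
  differentiable f x /\ 'd f x = f :> (E -> F).
Proof.
move=> [lf cf].
pose g : {linear E -> F} := HB.pack f (GRing.isLinear.Build _ _ _ _ f lf).
split; first exact: (@linear_differentiable _ _ _ g).
exact: (@diff_lin _ _ _ g).
Qed.

Lemma clin_comp E F G (f : E -> F) (g : F -> G) :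
  clin f -> clin g -> clin (fun x => g (f x)).
Proof.
move=> [lf cf] [lg cg]; split=> [a u v|x]; first by rewrite lf lg.
by apply: continuous_comp; [exact: cf|exact: cg].
Qed.

Lemma clin_pair E F G (f : E -> F) (g : E -> G) :
  clin f -> clin g -> clin (fun x => (f x, g x)).
Proof.
move=> [lf cf] [lg cg]; split=> [a u v|x]; first by rewrite lf lg.
by apply: cvg_pair; [exact: cf|exact: cg].
Qed.

Lemma clin_id E : clin (fun x : E => x).
Proof. by split=> // x; exact: cvg_id. Qed.

Lemma clin_fst E F : clin (fst : E * F -> E).
Proof. by split=> [a [? ?] [? ?] //|x]; exact: cvg_fst. Qed.

Lemma clin_snd E F : clin (snd : E * F -> F).
Proof. by split=> [a [? ?] [? ?] //|x]; exact: cvg_snd. Qed.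

Lemma clin_prod E F (f : E -> F) : clin f ->
  clin (fun p : E * E => (f p.1, f p.2)).
Proof.
move=> lf.
by apply: clin_pair; apply: (clin_comp _ lf); [exact: clin_fst|exact: clin_snd].
Qed.

Lemma Ck_clin k E F (U : set E) (f : E -> F) : open U -> clin f -> Ck k U f.
Proof.
elim: k E F U f => [|k IH] E F U f oU lf; first by move=> x _; apply: lf.2.
split; first by move=> x _; exact: (clin_diff x lf).1.
apply: (Ck_eq (f := fun p : E * E => (f p.1, f p.2))).
- exact: open_setMT.
- by move=> [x v] _ /=; rewrite (clin_diff x lf).2.
- by apply: IH; [exact: open_setMT|exact: clin_prod].
Qed.

Lemma Ck_comp_clin k E F G (U : set E) (f : E -> F) (g : F -> G) : open U ->
  clin g -> Ck k U f -> Ck k U (g \o f).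
Proof.
elim: k E F G U f g => [|k IH] E F G U f g oU lg /=.
  by move=> cf x Ux; apply: continuous_comp; [exact: cf|exact: lg.2].
move=> [f1 f2].
have dgf x : U x -> differentiable (g \o f) x /\
    'd (g \o f) x = g \o 'd f x :> (E -> G).
  move=> /f1 dfx; have [dg gE] := clin_diff (f x) lg.
  by split; [exact: differentiable_comp|rewrite diff_comp// gE].
split; first by move=> x /dgf[].
have := IH _ _ _ _ _ _ (open_setMT oU) (clin_prod lg) f2.
apply: Ck_eq; first exact: open_setMT.
by move=> [x v] [/= Ux _]; rewrite (dgf x Ux).2.
Qed.

Lemma clin_shuffle F G :
  clin (fun p : (F * F) * (G * G) => ((p.1.1, p.2.1), (p.1.2, p.2.2))).
Proof.
have fg1 := clin_fst (F * F)%type (G * G)%type.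
have fg2 := clin_snd (F * F)%type (G * G)%type.
by apply: clin_pair; apply: clin_pair;
  [apply: (clin_comp fg1)|apply: (clin_comp fg2)
  |apply: (clin_comp fg1)|apply: (clin_comp fg2)];
  do ?[exact: clin_fst|exact: clin_snd].
Qed.

(** The tangent map of a pair is the pair of tangent maps with the two middle factors exchanged;
    postcomposing with the linear shuffle closes the induction. *)
Lemma Ck_pair k E F G (U : set E) (f : E -> F) (g : E -> G) : open U ->
  Ck k U f -> Ck k U g -> Ck k U (fun x => (f x, g x)).
Proof.
elim: k E F G U f g => [|k IH] E F G U f g oU.
  by move=> hf hg x Ux; apply: cvg_pair; [exact: hf|exact: hg].
move=> [f1 f2] [g1 g2]; split.
  by move=> x Ux; apply: differentiable_pair; [exact: f1|exact: g1].
have Ch := IH _ _ _ _ _ _ (open_setMT oU) f2 g2.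
have := Ck_comp_clin (open_setMT oU) (clin_shuffle F G) Ch.
apply: Ck_eq; first exact: open_setMT.
by move=> [x v] [/= Ux _]; rewrite diff_pair//; [exact: f1|exact: g1].
Qed.

(** The chain rule reads T(g o f) = Tg o Tf, a composition of the same kind one order lower: the
    benefit of defining regularity by iterated tangent maps. *)
Lemma Ck_comp k E F G (U : set E) (W : set F) (f : E -> F) (g : F -> G) :
  open U -> (forall x, U x -> W (f x)) -> Ck k U f -> Ck k W g ->
  Ck k U (g \o f).
Proof.
elim: k E F G U W f g => [|k IH] E F G U W f g oU UW.
  by move=> cf cg x Ux; apply: continuous_comp; [exact: cf|apply: cg; exact: UW].
move=> [f1 f2] [g1 g2].
split.
  by move=> x Ux; apply: differentiable_comp; [exact: f1|apply: g1; exact: UW].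
have H := IH _ _ _ _ (W `*` [set: F]) _ _ (open_setMT oU) _ f2 g2.
apply: Ck_eq (H _); first exact: open_setMT.
- move=> [x v] [/= Ux _].
  have -> // : 'd (g \o f) x = 'd g (f x) \o 'd f x :> (E -> G).
  by apply: diff_comp; [exact: f1|apply: g1; exact: UW].
- by move=> [x v] [/= Ux _]; split => //; exact: UW.
Qed.

End CkTheory.

(** * Smooth germs and elementary functions *)

Section SmoothAt.
Context {R : realType}.
Implicit Types E F G : normedModType R.

Lemma clin_cst0 E F : clin (fun _ : E => 0 : F).
Proof. by split=> [a u v|x]; [rewrite scaler0 addr0|exact: cvg_cst]. Qed.

Lemma Ck_cst k E F (U : set E) (a : F) : open U -> Ck k U (fun=> a).
Proof.
elim: k F a => [|k IH] F a oU; first by move=> x _; exact: cvg_cst.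
split; first by move=> x _; exact: differentiable_cst.
have oUT := open_setMT (F := E) oU.
have c0 : Ck k (U `*` [set: E]) (fun=> 0 : F).
  by apply: Ck_clin => //; exact: clin_cst0.
have fE := clin_fst E E.
have UU (x : E * E) : (U `*` [set: E]) x -> U x.1 by case.
have := Ck_pair oUT (Ck_comp oUT UU (Ck_clin k oUT fE) (IH F a oU)) c0.
by apply: Ck_eq => // -[x v] [/= Ux _]; rewrite diff_cst.
Qed.

Lemma clin_add F : clin (fun p : F * F => p.1 + p.2).
Proof.
split=> [a [u u'] [v v']|p] /=; first by rewrite scalerDr addrACA.
exact: add_continuous.
Qed.

Lemma Ck_add k E F (U : set E) (f g : E -> F) : open U ->
  Ck k U f -> Ck k U g -> Ck k U (fun x => f x + g x).
Proof.
move=> oU cf cg.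
exact: (Ck_comp_clin oU (clin_add F) (Ck_pair oU cf cg)).
Qed.

(** The tangent map of the product is assembled from products of linear coordinates, so the
    induction hypothesis applies to the same function again. *)
Lemma Ck_mulr2 k : Ck k [set: R * R] (fun p : R * R => p.1 * p.2).
Proof.
elim: k => [|k IH]; first by move=> x _; exact: mul_continuous.
have dm (p : R * R) : differentiable (fun p : R * R => p.1 * p.2) p /\
    'd (fun p : R * R => p.1 * p.2) p
    = (fun v => p.1 * v.2 + p.2 * v.1) :> (R * R -> R).
  have d1 : is_diff p fst fst.
    by split; [exact: (clin_diff p (clin_fst _ _)).1
              |exact: (clin_diff p (clin_fst _ _)).2].
  have d2 : is_diff p snd snd.
    by split; [exact: (clin_diff p (clin_snd _ _)).1
              |exact: (clin_diff p (clin_snd _ _)).2].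
  have [h1 h2] := is_diffM d1 d2.
  by split=> //; rewrite h2; apply/funext => v.
split; first by move=> p _; exact: (dm p).1.
have oT : open ([set: R * R] `*` [set: R * R]) by apply: open_setMT; exact: openT.
pose E2 := ((R * R) * (R * R))%type.
have mulk (f g : E2 -> R) : clin f -> clin g ->
    Ck k ([set: R * R] `*` [set: R * R]) (fun p => f p * g p).
  move=> lf lg.
  exact: (Ck_comp oT (fun _ _ => I) (Ck_pair oT (Ck_clin k oT lf) (Ck_clin k oT lg)) IH).
have l1 : clin (fst : E2 -> _) by exact: clin_fst.
have l2 : clin (snd : E2 -> _) by exact: clin_snd.
have l11 := clin_comp l1 (clin_fst _ _).
have l12 := clin_comp l1 (clin_snd _ _).
have l21 := clin_comp l2 (clin_fst _ _).
have l22 := clin_comp l2 (clin_snd _ _).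
have := Ck_pair oT (mulk _ _ l11 l12) (Ck_add oT (mulk _ _ l11 l22) (mulk _ _ l12 l21)).
by apply: Ck_eq => // -[p v] _ /=; rewrite (dm p).2.
Qed.

Lemma Ck_mul k E (U : set E) (f g : E -> R) : open U ->
  Ck k U f -> Ck k U g -> Ck k U (fun x => f x * g x).
Proof.
move=> oU cf cg.
exact: (Ck_comp oU (fun _ _ => I) (Ck_pair oU cf cg) (Ck_mulr2 k)).
Qed.

(** In one variable the tangent map is [(x, v) |-> (f x, v * f' x)]. This bootstraps functions whose
    derivative is expressed through themselves: inverse, square root, cosine and sine. *)
Lemma Ck_derive1 k (U : set R) (f f' : R -> R) : open U ->
  (forall x, U x -> is_derive x 1 f (f' x)) ->
  Ck k U f' -> Ck k U f -> Ck k.+1 U f.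
Proof.
move=> oU fD cf' cf; split.
  by move=> x /fD fx; apply/derivable1_diffP; exact: ex_derive.
have oUT := open_setMT (F := R) oU.
have l1 := Ck_clin k oUT (clin_fst R R).
have l2 := Ck_clin k oUT (clin_snd R R).
have UU (x : R * R) : (U `*` [set: R]) x -> U x.1 by case.
have := Ck_pair oUT (Ck_comp oUT UU l1 cf)
  (Ck_mul oUT l2 (Ck_comp oUT UU l1 cf')).
apply: Ck_eq => // -[x v] [/= Ux _].
have fx := fD x Ux.
by rewrite deriv1E ?derive1E ?derive_val.
Qed.


Lemma Cinf_inv : Cinf [set x : R | x != 0] (fun x : R => x^-1).
Proof.
have oU : open [set x : R | x != 0] by exact: open_neq.
elim=> [|k IH]; first by move=> x x0; exact: inv_continuous.
apply: (Ck_derive1 (f' := fun x => -1 * (x^-1 * x^-1))) => //.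
  move=> x x0; split; first exact: derivableV.
  rewrite deriveV// derive_id -[LHS]mulrC mul1r mulN1r; congr (- _).
  by rewrite expr2 invfM.
apply: Ck_mul => //; first exact: Ck_cst.
exact: Ck_mul.
Qed.

Lemma Cinf_sqrt : Cinf [set x : R | 0 < x] (@Num.sqrt R).
Proof.
have oU : open [set x : R | 0 < x] by exact: open_gt.
elim=> [|k IH]; first by move=> x _; exact: sqrt_continuous.
apply: (Ck_derive1 (f' := fun x => (2 * Num.sqrt x)^-1)) => //.
apply: (Ck_comp (W := [set x | x != 0]) (f := fun x => 2 * Num.sqrt x)) => //.
- by move=> x /= x0; rewrite mulf_neq0// ?pnatr_eq0// gt_eqF// sqrtr_gt0.
- by apply: Ck_mul => //; exact: Ck_cst.
- exact: Cinf_inv.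
Qed.

Lemma Cinf_cos_sin :
  Cinf [set: R] (@cos R) /\ Cinf [set: R] (@sin R).
Proof.
suff H k : Ck k [set: R] (@cos R) /\ Ck k [set: R] (@sin R).
  by split=> k; have [] := H k.
have oU : open [set: R] by exact: openT.
elim: k => [|k [IHc IHs]].
  by split=> x _; [exact: continuous_cos|exact: continuous_sin].
have IHN : Ck k [set: R] (fun x : R => - sin x).
  have := Ck_mul oU (Ck_cst k (-1 : R) oU) IHs.
  by apply: Ck_eq => // x _; rewrite mulN1r.
split.
  by apply: (Ck_derive1 oU _ IHN IHc) => x _; exact: is_derive_cos.
by apply: (Ck_derive1 oU _ IHc IHs) => x _; exact: is_derive_sin.
Qed.

(** Working with germs confines all domain bookkeeping, such as nonzero denominators and positive
    radicands, to a condition at one point. *)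
Definition smooth_at E F (f : E -> F) x :=
  exists U : set E, [/\ open U, U x & Cinf U f].

Lemma smooth_at_eq E F (f g : E -> F) x : (\forall y \near x, f y = g y) ->
  smooth_at f x -> smooth_at g x.
Proof.
move=> fg; have : nbhs x [set y | f y = g y] by [].
rewrite nbhsE => -[W [oW Wx] Wfg] [U [oU Ux Uf]].
have oUW := openI oU oW.
exists (U `&` W); split => // k; apply: Ck_eq (Ck_sub _ (Uf k)) => //.
  by move=> y [_ /Wfg].
Qed.

Lemma smooth_at_diff E F (f : E -> F) x : smooth_at f x -> differentiable f x.
Proof. by move=> [U [oU Ux /(_ 1%N)[/(_ x Ux)]]]. Qed.

Lemma smooth_at_continuous E F (f : E -> F) x :
  smooth_at f x -> {for x, continuous f}.
Proof. by move=> /smooth_at_diff/differentiable_continuous. Qed.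

Lemma smooth_at_comp E F G (f : E -> F) (g : F -> G) x :
  smooth_at f x -> smooth_at g (f x) -> smooth_at (fun y => g (f y)) x.
Proof.
move=> [U [oU Ux Uf]] [W [oW Wx Wg]].
have oUW : open (U `&` f @^-1` W).
  by apply: open_preimage_on => // y; exact: Ck_continuous (Uf 0%N).
exists (U `&` f @^-1` W); split => // k.
by apply: (Ck_comp oUW _ (Ck_sub (@subIsetl _ _ _) (Uf k)) (Wg k)) => y [].
Qed.

Lemma smooth_at_pair E F G (f : E -> F) (g : E -> G) x :
  smooth_at f x -> smooth_at g x -> smooth_at (fun y => (f y, g y)) x.
Proof.
move=> [U [oU Ux Uf]] [W [oW Wx Wg]].
have oUW := openI oU oW.
exists (U `&` W); split => // k; apply: Ck_pair => //.
  by apply: Ck_sub (Uf k); exact: subIsetl.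
by apply: Ck_sub (Wg k); exact: subIsetr.
Qed.

Lemma smooth_at_clin E F (f : E -> F) x : clin f -> smooth_at f x.
Proof. by move=> lf; exists setT; split=> // [|k]; [exact: openT|apply: Ck_clin => //; exact: openT]. Qed.

Lemma smooth_at_cst E F (a : F) (x : E) : smooth_at (fun=> a) x.
Proof. by exists setT; split=> // [|k]; [exact: openT|apply: Ck_cst; exact: openT]. Qed.

Lemma smooth_at_id E (x : E) : smooth_at (fun y => y) x.
Proof. exact/smooth_at_clin/clin_id. Qed.

Lemma smooth_at_fst E F G (f : E -> F * G) x :
  smooth_at f x -> smooth_at (fun y => (f y).1) x.
Proof.
by move=> sf; exact: (smooth_at_comp sf (smooth_at_clin _ (clin_fst _ _))).
Qed.

Lemma smooth_at_snd E F G (f : E -> F * G) x :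
  smooth_at f x -> smooth_at (fun y => (f y).2) x.
Proof.
by move=> sf; exact: (smooth_at_comp sf (smooth_at_clin _ (clin_snd _ _))).
Qed.

Lemma smooth_at_add E F (f g : E -> F) x :
  smooth_at f x -> smooth_at g x -> smooth_at (fun y => f y + g y) x.
Proof.
move=> sf sg.
exact: (smooth_at_comp (smooth_at_pair sf sg) (smooth_at_clin _ (clin_add F))).
Qed.

Lemma smooth_at_sum E F (I : Type) (r : seq I) (f : I -> E -> F) x :
  (forall i, smooth_at (f i) x) -> smooth_at (fun y => \sum_(i <- r) f i y) x.
Proof.
move=> sf; elim: r => [|i r IH].
  by under eq_fun do rewrite big_nil; exact: smooth_at_cst.
under eq_fun do rewrite big_cons.
exact: smooth_at_add.
Qed.

Lemma smooth_at_mul E (f g : E -> R) x :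
  smooth_at f x -> smooth_at g x -> smooth_at (fun y => f y * g y) x.
Proof.
move=> sf sg.
have sm : smooth_at (fun p : R * R => p.1 * p.2) (f x, g x).
  by exists setT; split=> [|//|k]; [exact: openT|exact: Ck_mulr2].
exact: (smooth_at_comp (smooth_at_pair sf sg) sm).
Qed.

Lemma smooth_at_opp E (f : E -> R) x :
  smooth_at f x -> smooth_at (fun y => - f y) x.
Proof.
move=> sf; under eq_fun do rewrite -mulN1r.
by apply: smooth_at_mul => //; exact: smooth_at_cst.
Qed.

Lemma smooth_at_expn E (f : E -> R) m x :
  smooth_at f x -> smooth_at (fun y => f y ^+ m) x.
Proof.
move=> sf; elim: m => [|m IH].
  by under eq_fun do rewrite expr0; exact: smooth_at_cst.
under eq_fun do rewrite exprS.
exact: smooth_at_mul.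
Qed.

Lemma smooth_at_inv E (f : E -> R) x : f x != 0 ->
  smooth_at f x -> smooth_at (fun y => (f y)^-1) x.
Proof.
move=> fx0 sf; apply: (smooth_at_comp sf).
by exists [set y | y != 0]; split; [exact: open_neq| |exact: Cinf_inv].
Qed.

Lemma smooth_at_sqrt E (f : E -> R) x : 0 < f x ->
  smooth_at f x -> smooth_at (fun y => Num.sqrt (f y)) x.
Proof.
move=> fx0 sf; apply: (smooth_at_comp sf).
by exists [set y | 0 < y]; split; [exact: open_gt| |exact: Cinf_sqrt].
Qed.

Lemma smooth_at_cos E (f : E -> R) x :
  smooth_at f x -> smooth_at (fun y => cos (f y)) x.
Proof.
move=> sf; apply: (smooth_at_comp sf).
by exists setT; split; [exact: openT| |exact: Cinf_cos_sin.1].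
Qed.

Lemma smooth_at_sin E (f : E -> R) x :
  smooth_at f x -> smooth_at (fun y => sin (f y)) x.
Proof.
move=> sf; apply: (smooth_at_comp sf).
by exists setT; split; [exact: openT| |exact: Cinf_cos_sin.2].
Qed.

Lemma clin_coord m n i j : clin (fun M : 'M[R]_(m, n) => M i j).
Proof.
by split=> [a u v|M]; [rewrite !mxE|exact: coord_continuous].
Qed.

Lemma clin_scale_cst F (a : F) : clin (fun r : R => r *: a).
Proof.
split=> [k u v|r]; first by rewrite scalerDl -scalerA.
exact: scalel_continuous.
Qed.

Lemma smooth_at_coord E n (f : E -> 'rV[R]_n) j x :
  smooth_at f x -> smooth_at (fun y => f y 0 j) x.
Proof.
move=> sf.
exact: (smooth_at_comp sf (smooth_at_clin _ (@clin_coord _ _ 0 j))).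
Qed.

Lemma smooth_at_row E n (f : 'I_n -> E -> R) x :
  (forall j, smooth_at (f j) x) -> smooth_at (fun y => \row_j f j y) x.
Proof.
move=> sf.
have -> : (fun y => \row_j f j y) =
    (fun y => \sum_(j <- enum 'I_n) f j y *: delta_mx 0 j).
  apply/funext => y; rewrite [LHS]row_sum_delta big_enum.
  by apply: eq_bigr => j _; rewrite mxE.
apply: smooth_at_sum => j.
exact: (smooth_at_comp (sf j) (smooth_at_clin _ (clin_scale_cst _))).
Qed.

End SmoothAt.

(** * Smooth maps of V and isotopies *)

Section SmoothMaps.
Context {R : realType}.
Implicit Types E F G : normedModType R.

Lemma smooth_comp (T T' : Type) E F G (i : T -> E) (j : T' -> F) (h : T -> T')
    (g : T' -> G) :
  smooth i (fun t => j (h t)) -> smooth j g -> smooth i (fun t => g (h t)).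
Proof.
move=> sh sg t.
have [U [H [oU Ut cH HE]]] := sh t.
have [W [K [oW Wt cK KE]]] := sg (h t).
have oUW : open (U `&` H @^-1` W).
  by apply: open_preimage_on => // y; exact: Ck_continuous (cH 0%N).
exists (U `&` H @^-1` W), (K \o H); split => //.
- by split => //=; rewrite HE.
- by move=> k; apply: (Ck_comp oUW _ (Ck_sub _ (cH k)) (cK k)) => y [].
- by move=> s [Us /=]; rewrite HE// => Ws; rewrite KE.
Qed.

Lemma smooth_pair (T : Type) E F G (i : T -> E) (f : T -> F) (g : T -> G) :
  smooth i f -> smooth i g -> smooth i (fun t => (f t, g t)).
Proof.
move=> sf sg t.
have [U [H [oU Ut cH HE]]] := sf t.
have [W [K [oW Wt cK KE]]] := sg t.
have oUW := openI oU oW.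
exists (U `&` W), (fun y => (H y, K y)); split => //.
- move=> k; apply: Ck_pair => //.
    by apply: Ck_sub (cH k); exact: subIsetl.
  by apply: Ck_sub (cK k); exact: subIsetr.
- by move=> s [Us Ws]; rewrite HE// KE.
Qed.

Lemma smooth_of_smooth_at (T : Type) E F (i : T -> E) (f : E -> F) :
  (forall t, smooth_at f (i t)) -> smooth i (fun t => f (i t)).
Proof.
by move=> sf t; have [U [oU Ut cf]] := sf t; exists U, f.
Qed.

Lemma smooth_eq (T : Type) E F (i : T -> E) (f g : T -> F) :
  f =1 g -> smooth i f -> smooth i g.
Proof. by move=> /funext ->. Qed.

Lemma is_derive_diff_comp E F (c : R -> E) (f : E -> F) t v :
  is_derive t (1 : R) c v -> differentiable f (c t) ->
  is_derive t (1 : R) (f \o c) ('d f (c t) v).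
Proof.
move=> cv df.
have dc : differentiable c t by apply/derivable1_diffP; exact: ex_derive.
have dfc : differentiable (f \o c) t by exact: differentiable_comp.
apply: DeriveDef; first exact/derivable1_diffP.
have cE : 'd c t 1 = v by rewrite -deriveE//; exact: derive_val.
by rewrite deriveE// diff_comp//= cE.
Qed.

Lemma is_derive_clin E F (c : R -> E) (f : E -> F) t v :
  is_derive t (1 : R) c v -> clin f -> is_derive t (1 : R) (f \o c) (f v).
Proof.
move=> cv lf; have [df dE] := clin_diff (c t) lf.
by have := is_derive_diff_comp cv df; rewrite dE.
Qed.

Lemma is_derive_uniq E (c : R -> E) t v w :
  is_derive t (1 : R) c v -> is_derive t (1 : R) c w -> v = w.
Proof. by move=> [_ <-] [_ <-]. Qed.

End SmoothMaps.

Section Maps.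
Context {R : realType} {n : nat}.
Local Notation V := (V R n).
Implicit Types (f g h : V -> V) (p q : V) (c : R -> V) (v w : amb R n).
Local Notation I01 := (`[(0 : R), 1]%classic).

Definition smooth_family (H : R -> V -> V) :=
  smooth (fun tp : I01 * V => (val tp.1, val tp.2) : (R * amb R n)%type)
         (fun tp => val (H (val tp.1) tp.2)).

Lemma smooth_map_id : smooth_map (id : V -> V).
Proof.
apply: (smooth_of_smooth_at (f := fun x : amb R n => x)) => t.
exact: smooth_at_id.
Qed.

Lemma smooth_map_comp f g :
  smooth_map f -> smooth_map g -> smooth_map (g \o f).
Proof. by move=> sf sg; exact: smooth_comp sf sg. Qed.

Lemma smooth_family_cst f : smooth_map f -> smooth_family (fun=> f).
Proof.
move=> sf; apply: (smooth_comp (h := fun tp : I01 * V => tp.2) _ sf).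
apply: (smooth_of_smooth_at (f := fun x : R * amb R n => x.2)) => t.
exact/smooth_at_snd/smooth_at_id.
Qed.

Lemma smooth_family_time (H : R -> V -> V) :
  smooth_family H ->
  smooth (fun tp : I01 * V => (val tp.1, val tp.2) : (R * amb R n)%type)
         (fun tp => (val tp.1, val (H (val tp.1) tp.2)) : (R * amb R n)%type).
Proof.
apply: smooth_pair.
apply: (smooth_of_smooth_at (f := fun x : R * amb R n => x.1)) => t.
exact/smooth_at_fst/smooth_at_id.
Qed.

Lemma smooth_family_comp (H K : R -> V -> V) :
  smooth_family H -> smooth_family K -> smooth_family (fun t => K t \o H t).
Proof.
move=> sH sK.
exact: (smooth_comp (h := fun tp : I01 * V => (tp.1, H (val tp.1) tp.2))
  (smooth_family_time sH) sK).
Qed.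

Lemma smooth_family_rev (H : R -> V -> V) :
  smooth_family H -> smooth_family (fun t => H (1 - t)).
Proof.
move=> sH.
have rev01 (t : I01) : 1 - val t \in I01.
  have := valP t; rewrite !inE/= !in_itv/= => /andP[t0 t1].
  by rewrite subr_ge0 t1/= lerBlDr lerDl.
apply: (smooth_comp
  (h := fun tp : I01 * V => (SigSub (rev01 tp.1) : I01, tp.2)) _ sH) => /=.
apply: (smooth_of_smooth_at (f := fun x : R * amb R n => (1 - x.1, x.2))) => t.
apply: smooth_at_pair; last exact/smooth_at_snd/smooth_at_id.
apply: smooth_at_add; first exact: smooth_at_cst.
exact/smooth_at_opp/smooth_at_fst/smooth_at_id.
Qed.

(** The differential of a local extension of [g] serves as [L] for all curves through [p] at once.
    This independence of the curve is what makes velocities behave like tangent vectors. *)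
Lemma velocity_comp (F : normedModType R) (g : V -> F) p :
  smooth (fun q : V => val q : amb R n) g ->
  exists L : amb R n -> F, forall c v, has_velocity c p v ->
    is_derive (0 : R) (1 : R) (g \o c) (L v).
Proof.
move=> /(_ p)[U [G [oU Up cG GE]]].
have dG : differentiable G (val p) by case: (cG 1%N) => /(_ _ Up).
exists ('d G (val p)) => c v [cp cv].
apply: (@near_eq_is_derive _ _ _ (G \o (fun t => val (c t)))); last first.
  by rewrite -cp; apply: is_derive_diff_comp; rewrite ?cp.
have cc : {for (0 : R), continuous (fun t => val (c t) : amb R n)}.
  by apply: differentiable_continuous; apply/derivable1_diffP; exact: ex_derive.
near=> t; apply: GE; near: t; apply: cc; rewrite cp.
exact: open_nbhs_nbhs.
Unshelve. all: by end_near. Qed.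

Lemma velocity_map f p : smooth_map f ->
  exists L : amb R n -> amb R n, forall c v, has_velocity c p v ->
    has_velocity (f \o c) (f p) (L v).
Proof.
move=> sf; have [L LE] := velocity_comp p sf.
exists L => c v cv; split; first by rewrite /= cv.1.
exact: LE.
Qed.

(** The contact condition tested on curves. Only kernels of [lambda] are compared, so a conformal
    factor of either sign is allowed. *)
Definition preserves_lambda f := forall c p v w,
  has_velocity c p v -> has_velocity (f \o c) (f p) w ->
  (lambda (val p) v = 0 <-> lambda (val (f p)) w = 0).

Lemma preserves_lambda_comp f g : smooth_map f ->
  preserves_lambda f -> preserves_lambda g -> preserves_lambda (g \o f).
Proof.
move=> sf lf lg c p v w cv cw; have [L LE] := velocity_map p sf.
have := LE c v cv => cLv.
by rewrite (lf _ _ _ _ cv cLv); exact: (lg (f \o c)).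
Qed.

Lemma preserves_lambda_inv f g :
  cancel g f -> preserves_lambda f -> preserves_lambda g.
Proof.
move=> gf lf c p v w cv cw.
have := lf (g \o c) (g p) w v cw.
have -> : f \o (g \o c) = c by apply/funext => t /=; rewrite gf.
by rewrite gf => /(_ cv) ->.
Qed.

Lemma Diff_id : Diff (id : V -> V).
Proof. by split; [exact: smooth_map_id|exists id; split=> //; exact: smooth_map_id]. Qed.

Lemma Diff_comp f g : Diff f -> Diff g -> Diff (g \o f).
Proof.
move=> [sf [f' [sf' ff' f'f]]] [sg [g' [sg' gg' g'g]]].
split; first exact: smooth_map_comp.
exists (f' \o g'); split; [exact: smooth_map_comp|exact: can_comp|exact: can_comp].
Qed.

Lemma Diff_inv f g : Diff f -> cancel f g -> Diff g.
Proof.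
move=> [sf [f' [sf' ff' f'f]]] fg.
have -> : g = f' by apply/funext => x; rewrite -{1}(f'f x) fg.
by split => //; exists f.
Qed.

(** A velocity at [f p] comes from a unique velocity at [p], because the inverse map carries it
    back; so equality of the image of [xi] with [xi] amounts to equivalence of the two vanishing
    conditions. *)
Lemma Diff_xiP f : Diff_xi f <-> Diff f /\ preserves_lambda f.
Proof.
split=> [[Df fxi]|[Df lf]]; split => //.
- move=> c p v w cv cw.
  have [sf [g [sg fg gf]]] := Df.
  have /seteqP[sub1 sub2] := fxi p.
  split=> [v0|w0].
    suff [] : xi (f p) w by [].
    by apply: sub1; exists v; [split=> //; exists c|exists c].
  have [|v' [_ v'0] [c' [cv' cw']]] := sub2 w; first by split => //; exists (f \o c).
  suff -> : v = v' by [].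
  have [L LE] := velocity_map (f p) sg.
  have := LE _ _ cw; have := LE _ _ cw'.
  have gfc (d : R -> V) : g \o (f \o d) = d by apply/funext => x /=; rewrite fg.
  rewrite !gfc.
  move=> [_ h'] [_ h].
  by rewrite (is_derive_uniq cv.2 h) (is_derive_uniq cv'.2 h').
- move=> p; have [sf [g [sg fg gf]]] := Df; apply/seteqP; split=> w /=.
    move=> [v [_ v0] [c [cv cw]]]; split; first by exists (f \o c).
    by apply/(lf c p v w).
  move=> [[c cw] w0]; have [L LE] := velocity_map (f p) sg.
  have cv := LE _ _ cw; rewrite fg in cv.
  have fcE : f \o (g \o c) = c by apply/funext => x /=; rewrite gf.
  exists (L w).
    split; first by exists (g \o c).
    by apply/(lf (g \o c) p _ w); rewrite ?fcE.
  by exists (g \o c); rewrite fcE.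
Qed.

Lemma Diff_xi_id : Diff_xi (id : V -> V).
Proof.
apply/Diff_xiP; split; first exact: Diff_id.
by move=> c p v w cv cw; rewrite (is_derive_uniq cv.2 cw.2).
Qed.

Lemma Diff_xi_comp f g : Diff_xi f -> Diff_xi g -> Diff_xi (g \o f).
Proof.
move=> /Diff_xiP[Df lf] /Diff_xiP[Dg lg]; apply/Diff_xiP; split.
  exact: Diff_comp.
by apply: preserves_lambda_comp => //; case: Df.
Qed.

Lemma Diff_xi_inv f g : Diff_xi f -> cancel f g -> cancel g f -> Diff_xi g.
Proof.
move=> /Diff_xiP[Df lf] fg gf; apply/Diff_xiP; split; first exact: Diff_inv fg.
exact: preserves_lambda_inv lf.
Qed.

Lemma isotopic_refl (G : set (V -> V)) f : G f -> smooth_map f -> isotopic G f f.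
Proof. by move=> Gf sf; exists (fun=> f); split => //; exact: smooth_family_cst. Qed.

Lemma isotopic_sym (G : set (V -> V)) f g : isotopic G f g -> isotopic G g f.
Proof.
move=> [H [sH GH H0 H1]]; exists (fun t => H (1 - t)); split.
- exact: smooth_family_rev.
- by move=> t /andP[t0 t1]; apply: GH; rewrite subr_ge0 t1/= lerBlDr lerDl.
- by rewrite subr0.
- by rewrite subrr.
Qed.

Lemma isotopic_Diff f g : isotopic Diff f g -> Diff f /\ Diff g.
Proof.
by move=> [H [_ GH <- <-]]; split; apply: GH; rewrite ?lexx ?ler01.
Qed.

Lemma isotopic_xi_Diff f g : isotopic Diff_xi f g -> isotopic Diff f g.
Proof. by move=> [H [sH GH H0 H1]]; exists H; split => // t /GH []. Qed.

Lemma isotopic_comp f f' g g' : isotopic Diff f f' -> isotopic Diff g g' ->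
  isotopic Diff (g \o f) (g' \o f').
Proof.
move=> [H [sH GH H0 H1]] [K [sK GK K0 K1]].
exists (fun t => K t \o H t); split.
- exact: smooth_family_comp.
- by move=> t t01; apply: Diff_comp; [exact: GH|exact: GK].
- by rewrite H0 K0.
- by rewrite H1 K1.
Qed.

(* Diff is a group: [K_t \o g^-1 \o H_t] runs from [f] to [h], so that no
   smoothing of a concatenation is needed. *)
Lemma isotopic_trans f g h :
  isotopic Diff f g -> isotopic Diff g h -> isotopic Diff f h.
Proof.
move=> fg gh; have [_ Dg] := isotopic_Diff fg.
have [_ [g' [sg' gg' g'g]]] := Dg.
have Dg' := Diff_inv Dg gg'.
have g'i : isotopic Diff g' g' by apply: isotopic_refl.
have := isotopic_comp fg (isotopic_comp g'i gh).
have -> : (g \o g') \o f = f by apply/funext => x /=; rewrite g'g.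
by have -> : (h \o g') \o g = h by apply/funext => x /=; rewrite gg'.
Qed.

End Maps.

(** * The contact twist *)

Section ExplicitMaps.
Context {R : realType} {n : nat}.
Local Notation V := (V R n).
Local Notation amb := (amb R n).
Implicit Types (p q : amb).

Lemma amb_eq p q : (forall j, zx p j = zx q j) -> (forall j, zy p j = zy q j) ->
  sc p = sc q -> ca p = ca q -> cb p = cb q -> p = q.
Proof.
case: p q => [[[x y] s] [a b]] [[[x' y'] s'] [a' b']].
rewrite /zx /zy /sc /ca /cb /= => hx hy -> -> ->.
by congr (((_, _), _), _); apply/rowP.
Qed.

Definition sqn p := \sum_(j < n) (zx p j ^+ 2 + zy p j ^+ 2).

Lemma sqn_ge0 p : 0 <= sqn p.
Proof. by apply: sumr_ge0 => j _; rewrite addr_ge0// sqr_ge0. Qed.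

Definition rho p := sqn p ^+ 2 + 4 * sc p ^+ 2.

(* The positive root of [k * sqn p + (k * sc p) ^+ 2 = 1]: the flow
   (z, s) |-> (sqrt k z, k s), under which lambda is homogeneous of degree 1,
   meets V at time [kappa p]. *)
Definition kappa p := 2 / (sqn p + Num.sqrt (rho p)).

Definition dil (r k : R) p : amb :=
  ((\row_j (r * zx p j), \row_j (r * zy p j), k * sc p), (ca p, cb p)).

Definition nrm p := dil (Num.sqrt (kappa p)) (kappa p) p.

Definition onC p := ca p ^+ 2 + cb p ^+ 2 = 1.

Lemma rho_ge0 p : 0 <= rho p.
Proof. by rewrite addr_ge0// ?sqr_ge0// mulr_ge0// sqr_ge0. Qed.

Lemma rho_gt0 p : (0 < rho p) = (0 < sqn p) || (sc p != 0).
Proof.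
have s0 : 0 <= 4 * sc p ^+ 2 by rewrite mulr_ge0// sqr_ge0.
rewrite lt0r rho_ge0 andbT paddr_eq0 ?sqr_ge0//.
rewrite sqrf_eq0 [X in _ && X]mulf_eq0 pnatr_eq0/= sqrf_eq0 negb_and.
by rewrite lt0r sqn_ge0 andbT.
Qed.

Lemma kappa_gt0 p : 0 < rho p -> 0 < kappa p.
Proof. by move=> r0; rewrite divr_gt0// ltr_wpDl ?sqn_ge0// sqrtr_gt0. Qed.

(** With [a = sqn p] and [s = sc p], [kappa] is the positive root of [s^2 k^2 + a k = 1] in
    rationalised form: the conjugate sits in the denominator, so [s = 0] needs no separate case. *)
Lemma kappaP p : 0 < rho p ->
  (kappa p * sc p) ^+ 2 + kappa p * sqn p = 1.
Proof.
move=> r0; rewrite /kappa.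
have : Num.sqrt (rho p) ^+ 2 = rho p by rewrite sqr_sqrtr// ltW.
have : 0 < sqn p + Num.sqrt (rho p) by rewrite ltr_wpDl ?sqn_ge0// sqrtr_gt0.
rewrite {3}/rho; move: (Num.sqrt _) (sqn p) (sc p) => w a s D0 wE.
have D : a + w != 0 by rewrite gt_eqF.
suff -> : (2 / (a + w) * s) ^+ 2 + 2 / (a + w) * a =
  ((a ^+ 2 + 4 * s ^+ 2) - a ^+ 2 + 2 * a * (a + w)) / (a + w) ^+ 2.
  by rewrite -wE; field.
by field.
Qed.

(** Subtracting the equations of two positive solutions leaves their difference times a positive
    factor. Normalisations can then be identified without computing the root. *)
Lemma kappa_unique p k : 0 < k -> (k * sc p) ^+ 2 + k * sqn p = 1 ->
  kappa p = k.
Proof.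
move=> k0 kE.
have r0 : 0 < rho p.
  rewrite rho_gt0; apply: contra_eqT kE; rewrite negb_or -leNgt negbK.
  move=> /andP[a0 /eqP ->].
  have -> : sqn p = 0 by apply/eqP; rewrite eq_le a0 sqn_ge0.
  by rewrite !mulr0 expr0n addr0 eq_sym oner_eq0.
have := kappaP r0; have := kappa_gt0 r0.
move: (kappa p) => k' k'0 k'E.
have h : (k' - k) * (sqn p + (k' + k) * sc p ^+ 2) = 0.
  transitivity (((k' * sc p) ^+ 2 + k' * sqn p) - ((k * sc p) ^+ 2 + k * sqn p)).
    by ring.
  by rewrite k'E kE subrr.
have s0 : 0 < sqn p + (k' + k) * sc p ^+ 2.
  move: r0; rewrite rho_gt0 => /orP[a0|s0].
    by rewrite ltr_wpDr// mulr_ge0 ?sqr_ge0// addr_ge0// ltW.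
  by rewrite ltr_wpDl ?sqn_ge0// mulr_gt0 ?addr_gt0// exprn_even_gt0.
by move/eqP: h; rewrite mulf_eq0 (gt_eqF s0) orbF subr_eq0 => /eqP.
Qed.

Lemma zx_dil r k p j : zx (dil r k p) j = r * zx p j.
Proof. by rewrite /zx /= mxE. Qed.
Lemma zy_dil r k p j : zy (dil r k p) j = r * zy p j.
Proof. by rewrite /zy /= mxE. Qed.
Lemma sc_dil r k p : sc (dil r k p) = k * sc p. Proof. by []. Qed.

Lemma sqn_dil r k p : sqn (dil r k p) = r ^+ 2 * sqn p.
Proof.
rewrite /sqn mulr_sumr; apply: eq_bigr => j _.
by rewrite zx_dil zy_dil; ring.
Qed.

Lemma V_kappa p : V p -> 0 < rho p /\ kappa p = 1.
Proof.
move=> [h _]; have k1 : kappa p = 1.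
  by apply: kappa_unique; rewrite ?mul1r.
split=> //; rewrite rho_gt0; apply: contra_eqT h; rewrite negb_or -leNgt negbK.
move=> /andP[a0 /eqP ->].
rewrite -/(sqn p); have -> : sqn p = 0 by apply/eqP; rewrite eq_le a0 sqn_ge0.
by rewrite expr0n addr0 eq_sym oner_eq0.
Qed.

Lemma nrmV p : 0 < rho p -> onC p -> V (nrm p).
Proof.
move=> r0 oc; split; last exact: oc.
rewrite -/(sqn _) sqn_dil sc_dil sqr_sqrtr ?ltW ?kappa_gt0//.
exact: kappaP.
Qed.

(** [nrm] picks the point of V on a dilation orbit, and a point of V represents its own orbit. *)
Lemma nrm_dil k p : 0 < k -> V p -> nrm (dil (Num.sqrt k) k p) = p.
Proof.
move=> k0 [Vp _]; rewrite /nrm.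
have -> : kappa (dil (Num.sqrt k) k p) = k^-1.
  apply: kappa_unique; first by rewrite invr_gt0.
  by rewrite sc_dil sqn_dil sqr_sqrtr ?ltW// !mulKf ?gt_eqF//.
apply: amb_eq => //; try move=> j.
- by rewrite !zx_dil sqrtrV ?ltW// mulKf// gt_eqF// sqrtr_gt0.
- by rewrite !zy_dil sqrtrV ?ltW// mulKf// gt_eqF// sqrtr_gt0.
- by rewrite !sc_dil mulKf// gt_eqF.
Qed.

Definition mkV p (h : V p) : V := SigSub (mem_set h).

Context (l : 'I_n) (hl : l.+1 = n).

Lemma eq_last (j : 'I_n) : (j.+1 == n) = (j == l).
Proof. by rewrite -[RHS]eqSS hl. Qed.

Definition shear (t : R) p : amb :=
  (p.1.1, sc p - t * (zx p l ^+ 2 + zy p l ^+ 2), p.2).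

(** Where [z = 0] the shear does nothing, so it cannot send a point of V to [z = 0], [s = 0], where
    normalising breaks down. *)
Lemma rho_shear t p : V p -> 0 < rho (shear t p).
Proof.
move=> /V_kappa[]; rewrite !rho_gt0 => h _.
have [//|a0 /=] := boolP (0 < sqn p).
move: h; rewrite (negbTE a0)/= /shear /sc /=.
have -> : zx p l ^+ 2 + zy p l ^+ 2 = 0; last by rewrite mulr0 subr0.
apply/eqP; rewrite eq_le addr_ge0 ?sqr_ge0// andbT.
rewrite -leNgt in a0; apply: le_trans a0.
by rewrite /sqn (bigD1 l)//= lerDl; apply: sumr_ge0 => j _; rewrite addr_ge0// sqr_ge0.
Qed.

Lemma shearV t p : V p -> V (nrm (shear t p)).
Proof. by move=> Vp; apply: nrmV; [exact: rho_shear|case: Vp]. Qed.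

Definition shearM t (p : V) : V := mkV (shearV t (set_valP p)).

(** [|z_n|^2] and [s] have the same weight under the dilations, so the shear passes to orbits. This
    makes [shearM (- t)] inverse to [shearM t] despite the renormalisation. *)
Lemma shear_dil t k p : 0 < k ->
  shear t (dil (Num.sqrt k) k p) = dil (Num.sqrt k) k (shear t p).
Proof.
move=> k0; apply: amb_eq => //.
rewrite sc_dil {1 2}/shear {1}/sc [RHS]/= [LHS]/= zx_dil zy_dil sc_dil.
have rk : Num.sqrt k ^+ 2 = k by rewrite sqr_sqrtr// ltW.
by rewrite !exprMn rk -mulrDr mulrBr mulrCA.
Qed.

Lemma shearK t p : shear (- t) (shear t p) = p.
Proof. by apply: amb_eq => //; rewrite /shear /sc /zx /zy /=; ring. Qed.

Lemma shearMK t : cancel (shearM t) (shearM (- t)).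
Proof.
move=> p; apply: val_inj; rewrite /= {1}/nrm.
have r0 := rho_shear t (set_valP p).
rewrite -/(nrm _) /nrm -/(nrm _) shear_dil ?kappa_gt0// shearK.
by apply: nrm_dil; [exact: kappa_gt0|exact: set_valP].
Qed.

(** The plane is spanned by [x_n] and [s]; with [y_n] it spans the three-space in which the belt
    trick takes place. *)
Definition rotQ (c d : R) p : amb :=
  ((\row_j (if j == l then c * zx p l - d * sc p else zx p j), p.1.1.2,
    d * zx p l + c * sc p), p.2).

Lemma rotQV c d p : c ^+ 2 + d ^+ 2 = 1 -> V p -> V (rotQ c d p).
Proof.
move=> cd [Vp Vc]; split=> //; rewrite -[RHS]Vp.
rewrite (bigD1 l)// [in RHS](bigD1 l)//=.
rewrite (eq_bigr (fun j => zx p j ^+ 2 + zy p j ^+ 2)); last first.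
  by move=> j jl; rewrite /rotQ {1}/zx /= mxE (negbTE jl).
rewrite !addrA; congr (_ + _).
have -> : zx (rotQ c d p) l = c * zx p l - d * sc p.
  by rewrite {1}/zx /= mxE eqxx.
have -> : sc (rotQ c d p) = d * zx p l + c * sc p by [].
have -> : zy (rotQ c d p) l = zy p l by [].
congr (_ + _); rewrite -[RHS]mul1r -cd; ring.
Qed.

Definition rotM (t : R) (p : V) : V :=
  mkV (rotQV (cos2Dsin2 t) (set_valP p)).

Lemma rotMK t : cancel (rotM t) (rotM (- t)).
Proof.
move=> p; apply: val_inj; rewrite /=.
move: (val p) => q; have cs := cos2Dsin2 t.
apply: amb_eq => //=.
- move=> j; rewrite /rotQ cosN sinN {1}/zx /= mxE /sc/=.
  rewrite {1}/zx mxE eqxx; case: eqP => [->|/eqP jl].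
    rewrite /sc/= -[RHS]mul1r -cs; ring.
  by rewrite /zx/= mxE (negbTE jl).
- rewrite /rotQ cosN sinN /sc /= /zx/= mxE eqxx.
  by rewrite -[RHS]mul1r -cs /sc; ring.
Qed.

Definition PsiI_amb p : amb :=
  ((\row_j (if j.+1 == n then ca p * zx p j + cb p * zy p j else zx p j),
    \row_j (if j.+1 == n then - cb p * zx p j + ca p * zy p j else zy p j),
    sc p), (ca p, cb p)).

Lemma PsiI_ambV p : V p -> V (PsiI_amb p).
Proof.
move=> [Vp1 Vp2]; split=> //; rewrite -[RHS]Vp1; congr (_ + _).
apply: eq_bigr => j _; rewrite /zx /zy /= !mxE; case: ifP => // _.
rewrite -/(zx p j) -/(zy p j).
transitivity ((ca p ^+ 2 + cb p ^+ 2) * (zx p j ^+ 2 + zy p j ^+ 2)).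
  by ring.
by rewrite Vp2 mul1r.
Qed.

Definition PsiI (p : V) : V := mkV (PsiI_ambV (set_valP p)).

Lemma zx_Psi p j : zx (Psi_amb p) j =
  if j == l then ca p * zx p j - cb p * zy p j else zx p j.
Proof. by rewrite /zx /= mxE eq_last. Qed.

Lemma zy_Psi p j : zy (Psi_amb p) j =
  if j == l then cb p * zx p j + ca p * zy p j else zy p j.
Proof. by rewrite /zy /= mxE eq_last. Qed.

Lemma zx_PsiI p j : zx (PsiI_amb p) j =
  if j == l then ca p * zx p j + cb p * zy p j else zx p j.
Proof. by rewrite /zx /= mxE eq_last. Qed.

Lemma zy_PsiI p j : zy (PsiI_amb p) j =
  if j == l then - cb p * zx p j + ca p * zy p j else zy p j.
Proof. by rewrite /zy /= mxE eq_last. Qed.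

Lemma ca_Psi p : ca (Psi_amb p) = ca p. Proof. by []. Qed.
Lemma cb_Psi p : cb (Psi_amb p) = cb p. Proof. by []. Qed.
Lemma ca_PsiI p : ca (PsiI_amb p) = ca p. Proof. by []. Qed.
Lemma cb_PsiI p : cb (PsiI_amb p) = cb p. Proof. by []. Qed.

Lemma Psi_ambK p : onC p -> PsiI_amb (Psi_amb p) = p.
Proof.
move=> pc; apply: amb_eq => // j.
  rewrite zx_PsiI zx_Psi zy_Psi ca_Psi cb_Psi; case: (j == l) => //.
  by rewrite -[RHS]mul1r -pc; ring.
rewrite zy_PsiI zx_Psi zy_Psi ca_Psi cb_Psi; case: (j == l) => //.
by rewrite -[RHS]mul1r -pc; ring.
Qed.

Lemma PsiI_ambK p : onC p -> Psi_amb (PsiI_amb p) = p.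
Proof.
move=> pc; apply: amb_eq => // j.
  rewrite zx_Psi zx_PsiI zy_PsiI ca_PsiI cb_PsiI; case: (j == l) => //.
  by rewrite -[RHS]mul1r -pc; ring.
rewrite zy_Psi zx_PsiI zy_PsiI ca_PsiI cb_PsiI; case: (j == l) => //.
by rewrite -[RHS]mul1r -pc; ring.
Qed.

Lemma PsiK : cancel (@Psi R n) PsiI.
Proof. by move=> p; apply: val_inj; apply: Psi_ambK; have [] := set_valP p. Qed.

Lemma PsiIK : cancel PsiI (@Psi R n).
Proof. by move=> p; apply: val_inj; apply: PsiI_ambK; have [] := set_valP p. Qed.

End ExplicitMaps.

Section SmoothCoordinates.
Context {R : realType} {n : nat}.
Local Notation amb := (amb R n).
Context {E : normedModType R} (f : E -> amb) (x : E) (sf : smooth_at f x).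

Lemma smooth_at_zx j : smooth_at (fun y => zx (f y) j) x.
Proof. by apply: smooth_at_coord; do 3![apply: smooth_at_fst]. Qed.
Lemma smooth_at_zy j : smooth_at (fun y => zy (f y) j) x.
Proof. by apply: smooth_at_coord; apply: smooth_at_snd; do 2![apply: smooth_at_fst]. Qed.
Lemma smooth_at_sc : smooth_at (fun y => sc (f y)) x.
Proof. by apply: smooth_at_snd; apply: smooth_at_fst. Qed.
Lemma smooth_at_ca : smooth_at (fun y => ca (f y)) x.
Proof. by apply: smooth_at_fst; apply: smooth_at_snd. Qed.
Lemma smooth_at_cb : smooth_at (fun y => cb (f y)) x.
Proof. by apply: smooth_at_snd; apply: smooth_at_snd. Qed.

Lemma smooth_at_sqn : smooth_at (fun y => sqn (f y)) x.
Proof.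
apply: smooth_at_sum => j.
by apply: smooth_at_add; apply: smooth_at_expn; [exact: smooth_at_zx|exact: smooth_at_zy].
Qed.

Lemma smooth_at_rho : smooth_at (fun y => rho (f y)) x.
Proof.
apply: smooth_at_add; first exact/smooth_at_expn/smooth_at_sqn.
by apply: smooth_at_mul; [exact: smooth_at_cst|exact/smooth_at_expn/smooth_at_sc].
Qed.

Lemma smooth_at_kappa : 0 < rho (f x) -> smooth_at (fun y => kappa (f y)) x.
Proof.
move=> r0; apply: smooth_at_mul; first exact: smooth_at_cst.
apply: smooth_at_inv; first by rewrite gt_eqF// ltr_wpDl ?sqn_ge0// sqrtr_gt0.
by apply: smooth_at_add; [exact: smooth_at_sqn|exact/smooth_at_sqrt/smooth_at_rho].
Qed.

Lemma smooth_at_nrm : 0 < rho (f x) -> smooth_at (fun y => nrm (f y)) x.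
Proof.
move=> r0; have sk := smooth_at_kappa r0.
have ssk : smooth_at (fun y => Num.sqrt (kappa (f y))) x.
  by apply: smooth_at_sqrt => //; exact: kappa_gt0.
apply: smooth_at_pair; first apply: smooth_at_pair; first apply: smooth_at_pair.
- by apply: smooth_at_row => j; apply: smooth_at_mul => //; exact: smooth_at_zx.
- by apply: smooth_at_row => j; apply: smooth_at_mul => //; exact: smooth_at_zy.
- by apply: smooth_at_mul => //; exact: smooth_at_sc.
- exact: smooth_at_pair smooth_at_ca smooth_at_cb.
Qed.

Lemma smooth_at_shear l (t : E -> R) :
  smooth_at t x -> smooth_at (fun y => shear l (t y) (f y)) x.
Proof.
move=> st; apply: smooth_at_pair; last exact: smooth_at_snd.
apply: smooth_at_pair; first by do 2![apply: smooth_at_fst].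
apply: smooth_at_add; first exact: smooth_at_sc.
apply: smooth_at_opp; apply: smooth_at_mul => //.
by apply: smooth_at_add; apply: smooth_at_expn; [exact: smooth_at_zx|exact: smooth_at_zy].
Qed.

Lemma smooth_at_rotQ l (c d : E -> R) :
  smooth_at c x -> smooth_at d x -> smooth_at (fun y => rotQ l (c y) (d y) (f y)) x.
Proof.
move=> sc' sd; apply: smooth_at_pair; last exact: smooth_at_snd.
have sx := smooth_at_zx l; have ss := smooth_at_sc.
apply: smooth_at_pair; first apply: smooth_at_pair.
- apply: smooth_at_row => j; case: (j == l); last exact: smooth_at_zx.
  apply: smooth_at_add; first exact: smooth_at_mul.
  by apply: smooth_at_opp; exact: smooth_at_mul.
- by apply: smooth_at_snd; do 2![apply: smooth_at_fst].
- by apply: smooth_at_add; exact: smooth_at_mul.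
Qed.

Lemma smooth_at_Psi : smooth_at (fun y => Psi_amb (f y)) x.
Proof.
have sa := smooth_at_ca; have sb := smooth_at_cb.
have sx := smooth_at_zx; have sy := smooth_at_zy.
apply: smooth_at_pair; last exact: smooth_at_pair.
apply: smooth_at_pair; last exact: smooth_at_sc.
apply: smooth_at_pair; apply: smooth_at_row => j; case: (j.+1 == n) => //.
  apply: smooth_at_add; first exact: smooth_at_mul.
  by apply: smooth_at_opp; exact: smooth_at_mul.
by apply: smooth_at_add; exact: smooth_at_mul.
Qed.

Lemma smooth_at_PsiI : smooth_at (fun y => PsiI_amb (f y)) x.
Proof.
have sa := smooth_at_ca; have sb := smooth_at_cb.
have sx := smooth_at_zx; have sy := smooth_at_zy.
apply: smooth_at_pair; last exact: smooth_at_pair.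
apply: smooth_at_pair; last exact: smooth_at_sc.
apply: smooth_at_pair; apply: smooth_at_row => j; case: (j.+1 == n) => //.
  by apply: smooth_at_add; exact: smooth_at_mul.
apply: smooth_at_add; last exact: smooth_at_mul.
by apply: smooth_at_mul => //; exact: smooth_at_opp.
Qed.

End SmoothCoordinates.

(** * Smooth isotopies of the twist and of its square *)

Section ContactTwist.
Context {R : realType} {n : nat} (l : 'I_n) (hl : l.+1 = n).
Local Notation V := (V R n).
Local Notation amb := (amb R n).
Implicit Types (f g : V -> V) (p q : V) (c : R -> V) (v w : amb).
Local Notation Psi := (@Psi R n).
Local Notation shearM := (@shearM R n l).
Local Notation rotM := (@rotM R n l).

Lemma smooth_map_amb f (F : amb -> amb) :
  (forall p, val (f p) = F (val p)) -> (forall p, smooth_at F (val p)) ->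
  smooth_map f.
Proof.
move=> fF sF; apply: (smooth_eq (f := fun p : V => F (val p))) => //.
exact: smooth_of_smooth_at.
Qed.

Lemma smooth_family_amb (H : R -> V -> V) (F : R * amb -> amb) :
  (forall t p, val (H t p) = F (t, val p)) ->
  (forall t p, smooth_at F (t, val p)) -> smooth_family H.
Proof.
move=> fF sF; apply: (smooth_eq
  (f := fun tp : `[(0 : R), 1]%classic * V => F (val tp.1, val tp.2))) => //.
by apply: smooth_of_smooth_at => tp; exact: sF.
Qed.

Lemma Diff_Psi : Diff Psi.
Proof.
split.
  by apply: (@smooth_map_amb _ (@Psi_amb R n)) => // p; exact/smooth_at_Psi/smooth_at_id.
exists (@PsiI R n); split; [|exact: (PsiK hl)|exact: (PsiIK hl)].
by apply: (@smooth_map_amb _ (@PsiI_amb R n)) => // p; exact/smooth_at_PsiI/smooth_at_id.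
Qed.

Lemma smooth_family_shear (s : R) : smooth_family (fun t => shearM (s * t)).
Proof.
apply: (@smooth_family_amb _ (fun x => nrm (shear l (s * x.1) x.2))) => // t p.
apply: smooth_at_nrm; last exact: (rho_shear l _ (set_valP p)).
apply: smooth_at_shear; first exact/smooth_at_snd/smooth_at_id.
apply: smooth_at_mul; first exact: smooth_at_cst.
exact/smooth_at_fst/smooth_at_id.
Qed.

Lemma smooth_map_shear t : smooth_map (shearM t).
Proof.
apply: (@smooth_map_amb _ (fun x => nrm (shear l t x))) => // p.
apply: smooth_at_nrm; last exact: (rho_shear l _ (set_valP p)).
apply: (@smooth_at_shear _ _ _ id _ _ l (fun=> t)); first exact: smooth_at_id.
exact: smooth_at_cst.
Qed.

Lemma Diff_shear t : Diff (shearM t).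
Proof.
split; first exact: smooth_map_shear.
exists (shearM (- t)); split; [exact: smooth_map_shear|exact: shearMK|].
by move=> p; rewrite -{1}(opprK t) shearMK.
Qed.

Lemma smooth_family_rot (s : R) : smooth_family (fun t => rotM (s * t)).
Proof.
apply: (@smooth_family_amb _
  (fun x => rotQ l (cos (s * x.1)) (sin (s * x.1)) x.2)) => // t p.
have sm : smooth_at (fun x : R * amb => s * x.1) (t, val p).
  apply: smooth_at_mul; first exact: smooth_at_cst.
  exact/smooth_at_fst/smooth_at_id.
apply: smooth_at_rotQ; first exact/smooth_at_snd/smooth_at_id.
  exact: smooth_at_cos.
exact: smooth_at_sin.
Qed.

Lemma smooth_map_rot t : smooth_map (rotM t).
Proof.
apply: (@smooth_map_amb _ (fun x => rotQ l (cos t) (sin t) x)) => // p.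
by apply: (@smooth_at_rotQ _ _ _ id _ _ l (fun=> cos t) (fun=> sin t));
  [exact: smooth_at_id|exact: smooth_at_cst|exact: smooth_at_cst].
Qed.

Lemma Diff_rot t : Diff (rotM t).
Proof.
split; first exact: smooth_map_rot.
exists (rotM (- t)); split; [exact: smooth_map_rot|exact: rotMK|].
by move=> p; rewrite -{1}(opprK t) rotMK.
Qed.

(** The map [Psi_c] of the theorem. Twisting [z_n] by [theta] adds [|z_n|^2 d theta / 2] to
    [lambda], and the shear with parameter 1/2 removes exactly this. *)
Definition Phi : V -> V := shearM 2^-1 \o Psi.
Definition PhiI : V -> V := @PsiI R n \o shearM (- 2^-1).

Lemma PhiK : cancel Phi PhiI.
Proof. by move=> p; rewrite /Phi /PhiI /= shearMK (PsiK hl). Qed.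

Lemma PhiIK : cancel PhiI Phi.
Proof. by move=> p; rewrite /Phi /PhiI /= (PsiIK hl) -{1}(opprK 2^-1) shearMK. Qed.

Lemma Diff_Phi : Diff Phi.
Proof. by apply: Diff_comp; [exact: Diff_Psi|exact: Diff_shear]. Qed.

Lemma shearM0 : shearM 0 = id.
Proof.
apply/funext => p; apply: val_inj => /=.
have [_ k1] := V_kappa (set_valP p).
have -> : shear l 0 (val p) = val p.
  by apply: amb_eq => //; rewrite {1}/sc /= mul0r subr0.
rewrite /nrm k1 sqrtr1.
by apply: amb_eq => [j|j||//|//]; rewrite ?zx_dil ?zy_dil ?sc_dil mul1r.
Qed.

Lemma isotopic_Psi_Phi : isotopic Diff Psi Phi.
Proof.
exists (fun t => shearM (2^-1 * t) \o Psi); split.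
- exact: (smooth_family_comp (smooth_family_cst Diff_Psi.1)
                             (smooth_family_shear 2^-1)).
- by move=> t _; apply: Diff_comp; [exact: Diff_Psi|exact: Diff_shear].
- by rewrite mulr0 shearM0.
- by rewrite mulr1.
Qed.

Lemma rotM0 : rotM 0 = id.
Proof.
apply/funext => p; apply: val_inj => /=; rewrite cos0 sin0.
apply: amb_eq => // [j|]; last by rewrite {1}/sc /= mul0r mul1r add0r.
rewrite {1}/zx /= mxE mul0r mul1r subr0.
by case: eqP => // ->.
Qed.

(** The half turn negates [x_n] and [s]. On the [z_n]-plane it is a reflection, and conjugating a
    rotation by a reflection inverts it. *)
Lemma rot_pi_Psi : rotM pi \o Psi \o rotM (- pi) = @PsiI R n.
Proof.
apply/funext => p; apply: val_inj => /=; rewrite cosN sinN cospi sinpi oppr0.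
move: (sval p) => q.
have zxr (q' : amb) j :
    zx (rotQ l (-1) 0 q') j = if j == l then - zx q' l else zx q' j.
  by rewrite {1}/zx /= mxE mul0r subr0 mulN1r.
have zyr (q' : amb) j : zy (rotQ l (-1) 0 q') j = zy q' j by [].
have scr (q' : amb) : sc (rotQ l (-1) 0 q') = - sc q'.
  by rewrite {1}/sc /= mul0r add0r mulN1r.
have car (q' : amb) : ca (rotQ l (-1) 0 q') = ca q' by [].
have cbr (q' : amb) : cb (rotQ l (-1) 0 q') = cb q' by [].
apply: amb_eq => // [j|j|].
- rewrite zxr !(zx_Psi hl) (zx_PsiI hl) !zxr zyr eqxx car cbr.
  by case: eqP => // ->; ring.
- rewrite zyr !(zy_Psi hl) (zy_PsiI hl) !zxr zyr car cbr.
  by case: eqP => // ->; ring.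
- by rewrite scr -[RHS]opprK; congr (- _); rewrite -[LHS]/(sc (rotQ l (-1) 0 q)) scr.
Qed.

(* The belt trick: conjugating the first rotation by a rotation of angle
   [pi * t] in the (x_n, s)-plane reverses its axis. *)
Lemma isotopic_Psi2_id : isotopic Diff (Psi \o Psi) id.
Proof.
exists (fun t => (rotM (pi * t) \o Psi \o rotM (- pi * t)) \o Psi); split.
- have sPsi := smooth_family_cst Diff_Psi.1.
  have s1 := smooth_family_comp (smooth_family_rot (- pi)) sPsi.
  have s2 := smooth_family_comp s1 (smooth_family_rot pi).
  exact: smooth_family_comp sPsi s2.
- move=> t _; apply: Diff_comp; first exact: Diff_Psi.
  apply: Diff_comp; first exact: Diff_rot.
  by apply: Diff_comp; [exact: Diff_Psi|exact: Diff_rot].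
- by rewrite !mulr0 rotM0.
- rewrite !mulr1 rot_pi_Psi; apply/funext => p; exact: (PsiK hl).
Qed.

Lemma isotopic_Phi2_id : isotopic Diff (Phi \o Phi) id.
Proof.
apply: isotopic_trans isotopic_Psi2_id.
by apply: isotopic_comp; apply: isotopic_sym; exact: isotopic_Psi_Phi.
Qed.

End ContactTwist.

(** * Effect of the twist and the shear on the contact form *)

Section Velocities.
Context {R : realType} {n : nat}.
Local Notation V := (V R n).
Local Notation amb := (amb R n).
Implicit Types (p q : V) (c : R -> V) (v w : amb).
Local Notation "f '^D' d" := (is_derive (0 : R) (1 : R) f d) (at level 70).

Lemma val_sphere p :
  sc (val p) ^+ 2 + \sum_(j < n) (zx (val p) j ^+ 2 + zy (val p) j ^+ 2) = 1.
Proof. exact: (set_valP p).1. Qed.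
Lemma val_circle p : ca (val p) ^+ 2 + cb (val p) ^+ 2 = 1.
Proof. exact: (set_valP p).2. Qed.

Lemma clin_xy : clin (fun p : amb => p.1.1).
Proof. exact: clin_comp (clin_fst _ _) (clin_fst _ _). Qed.
Lemma clin_zx j : clin (fun p : amb => zx p j).
Proof. exact: clin_comp (clin_comp clin_xy (clin_fst _ _)) (clin_coord 0 j). Qed.
Lemma clin_zy j : clin (fun p : amb => zy p j).
Proof. exact: clin_comp (clin_comp clin_xy (clin_snd _ _)) (clin_coord 0 j). Qed.
Lemma clin_sc : clin (@sc R n).
Proof. exact: clin_comp (clin_fst _ _) (clin_snd _ _). Qed.
Lemma clin_ca : clin (@ca R n).
Proof. exact: clin_comp (clin_snd _ _) (clin_fst _ _). Qed.
Lemma clin_cb : clin (@cb R n).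
Proof. exact: clin_comp (clin_snd _ _) (clin_snd _ _). Qed.

Section Coordinates.
Variables (c : R -> V) (p : V) (v : amb) (cv : has_velocity c p v).
Lemma vel0 : c 0 = p. Proof. exact: cv.1. Qed.
Lemma vel_zx j : (fun t => zx (val (c t)) j) ^D (zx v j).
Proof. exact: is_derive_clin cv.2 (clin_zx j). Qed.
Lemma vel_zy j : (fun t => zy (val (c t)) j) ^D (zy v j).
Proof. exact: is_derive_clin cv.2 (clin_zy j). Qed.
Lemma vel_sc : (fun t => sc (val (c t))) ^D (sc v).
Proof. exact: is_derive_clin cv.2 clin_sc. Qed.
Lemma vel_ca : (fun t => ca (val (c t))) ^D (ca v).
Proof. exact: is_derive_clin cv.2 clin_ca. Qed.
Lemma vel_cb : (fun t => cb (val (c t))) ^D (cb v).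
Proof. exact: is_derive_clin cv.2 clin_cb. Qed.
End Coordinates.

Lemma der_mul (f g : R -> R) a b : f ^D a -> g ^D b ->
  (fun t => f t * g t) ^D (f 0 * b + g 0 * a).
Proof. by move=> fa gb; exact: is_deriveM. Qed.

Lemma der_add (f g : R -> R) a b : f ^D a -> g ^D b ->
  (fun t => f t + g t) ^D (a + b).
Proof. by move=> fa gb; exact: is_deriveD. Qed.

Lemma der_sub (f g : R -> R) a b : f ^D a -> g ^D b ->
  (fun t => f t - g t) ^D (a - b).
Proof. by move=> fa gb; exact: is_deriveB. Qed.

Lemma der_scale (k : R) (f : R -> R) a : f ^D a -> (fun t => k * f t) ^D (k * a).
Proof. by move=> fa; exact: is_deriveZ. Qed.

Lemma der_sum (f : 'I_n -> R -> R) a : (forall j, f j ^D a j) ->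
  (fun t => \sum_(j < n) f j t) ^D (\sum_(j < n) a j).
Proof.
move=> fa; have := is_derive_sum fa.
have -> // : (fun t => \sum_(j < n) f j t) = \sum_(j < n) f j.
by apply/funext => t; rewrite fct_sumE.
Qed.

Lemma velocity_V c p v : has_velocity c p v ->
  sc (val p) * sc v + \sum_(j < n) (zx (val p) j * zx v j + zy (val p) j * zy v j) = 0
  /\ ca (val p) * ca v + cb (val p) * cb v = 0.
Proof.
move=> cv; have c0 := vel0 cv.
have sq (f : R -> R) a : f ^D a -> (fun t => f t ^+ 2) ^D (2 * (f 0 * a)).
  move=> fa; have := der_mul fa fa.
  by rewrite mulrDl !mul1r.
have cst (f : R -> R) a : f ^D a -> (forall t, f t = 1) -> a = 0.
  move=> fa f1; apply: (is_derive_uniq fa).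
  have -> : f = cst 1 by apply/funext.
  exact: is_derive_cst.
split.
- have h := der_add (sq _ _ (vel_sc cv))
    (der_sum (fun j => der_add (sq _ _ (vel_zx cv j)) (sq _ _ (vel_zy cv j)))).
  have := cst _ _ h (fun t => val_sphere (c t)).
  rewrite c0; under eq_bigr do rewrite -mulrDr.
  by rewrite -mulr_sumr -mulrDr => /eqP; rewrite mulf_eq0 pnatr_eq0 => /eqP.
- have h := der_add (sq _ _ (vel_ca cv)) (sq _ _ (vel_cb cv)).
  have := cst _ _ h (fun t => val_circle (c t)).
  by rewrite c0 -mulrDr => /eqP; rewrite mulf_eq0 pnatr_eq0 => /eqP.
Qed.

Definition dtheta (p v : amb) := ca p * cb v - cb p * ca v.
Definition wedge (p v : amb) :=
  \sum_(j < n) (zx p j * zy v j - zy p j * zx v j).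

Lemma lambdaE (p v : amb) : lambda p v = sc p * dtheta p v + 2^-1 * wedge p v.
Proof. by []. Qed.

Context (l : 'I_n) (hl : l.+1 = n).
Local Notation Psi := (@Psi R n).
Local Notation shearM := (@shearM R n l).

Lemma vel_Psi c p v w :
  has_velocity c p v -> has_velocity (Psi \o c) (Psi p) w ->
  [/\ forall j, zx w j = if j == l then
        (ca (val p) * zx v l + zx (val p) l * ca v) -
        (cb (val p) * zy v l + zy (val p) l * cb v) else zx v j,
      forall j, zy w j = if j == l then
        (cb (val p) * zx v l + zx (val p) l * cb v) +
        (ca (val p) * zy v l + zy (val p) l * ca v) else zy v j,
      sc w = sc v, ca w = ca v & cb w = cb v].
Proof.
move=> cv cw; have c0 := vel0 cv; split.
- move=> j; apply: is_derive_uniq (vel_zx cw j) _.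
  under eq_fun do rewrite /= (zx_Psi hl).
  case: (j =P l) => [->|_]; last exact: vel_zx cv j.
  rewrite -c0.
  exact: der_sub (der_mul (vel_ca cv) (vel_zx cv l)) (der_mul (vel_cb cv) (vel_zy cv l)).
- move=> j; apply: is_derive_uniq (vel_zy cw j) _.
  under eq_fun do rewrite /= (zy_Psi hl).
  case: (j =P l) => [->|_]; last exact: vel_zy cv j.
  rewrite -c0.
  exact: der_add (der_mul (vel_cb cv) (vel_zx cv l)) (der_mul (vel_ca cv) (vel_zy cv l)).
- exact: is_derive_uniq (vel_sc cw) (vel_sc cv).
- exact: is_derive_uniq (vel_ca cw) (vel_ca cv).
- exact: is_derive_uniq (vel_cb cw) (vel_cb cv).
Qed.

(** [r'] is the derivative of the scaling factor [sqrt kappa]. Its value is left open: it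
    contributes only a multiple of the radial vector, which [wedge] ignores. *)
Lemma vel_shear t c p v w :
  has_velocity c p v -> has_velocity (shearM t \o c) (shearM t p) w ->
  exists r', [/\ forall j, zx w j = Num.sqrt (kappa (shear l t (val p))) * zx v j
                                    + zx (val p) j * r',
    forall j, zy w j = Num.sqrt (kappa (shear l t (val p))) * zy v j
                       + zy (val p) j * r',
    ca w = ca v & cb w = cb v].
Proof.
move=> cv cw; have c0 := vel0 cv.
pose r := fun q : V => Num.sqrt (kappa (shear l t (val q))).
have sr : smooth (fun q : V => val q : amb) r.
  apply: (smooth_of_smooth_at (f := fun x => Num.sqrt (kappa (shear l t x)))) => q.
  have r0 := rho_shear l t (set_valP q).
  apply: smooth_at_sqrt; first exact: kappa_gt0.
  apply: smooth_at_kappa => //.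
  by apply: (@smooth_at_shear _ _ _ id _ _ l (fun=> t)); [exact: smooth_at_id|exact: smooth_at_cst].
have [L LE] := velocity_comp p sr; have rv := LE c v cv.
exists (L v); split.
- move=> j; apply: is_derive_uniq (vel_zx cw j) _.
  under eq_fun do rewrite /= zx_dil.
  by have := der_mul rv (vel_zx cv j); rewrite /= c0.
- move=> j; apply: is_derive_uniq (vel_zy cw j) _.
  under eq_fun do rewrite /= zy_dil.
  by have := der_mul rv (vel_zy cv j); rewrite /= c0.
- exact: is_derive_uniq (vel_ca cw) (vel_ca cv).
- exact: is_derive_uniq (vel_cb cw) (vel_cb cv).
Qed.

(** [wedge] is the sum of the [r_j^2 d phi_j], and multiplying [z_n] by [e^(i theta)] turns
    [d phi_n] into [d phi_n + d theta]. *)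
Lemma wedge_Psi (q v w : amb) : onC q ->
  (forall j, zx w j = if j == l then
        (ca q * zx v l + zx q l * ca v) -
        (cb q * zy v l + zy q l * cb v) else zx v j) ->
  (forall j, zy w j = if j == l then
        (cb q * zx v l + zx q l * cb v) +
        (ca q * zy v l + zy q l * ca v) else zy v j) ->
  wedge (Psi_amb q) w =
    wedge q v + (zx q l ^+ 2 + zy q l ^+ 2) * dtheta q v.
Proof.
move=> qc wx wy; rewrite /wedge (bigD1 l)//= [in RHS](bigD1 l)//=.
rewrite (eq_bigr (fun j => zx q j * zy v j - zy q j * zx v j)).
  2: by move=> j jl; rewrite wx wy (zx_Psi hl) (zy_Psi hl) (negbTE jl).
rewrite wx wy (zx_Psi hl) (zy_Psi hl) eqxx [RHS]addrAC; congr (_ + _).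
by rewrite /dtheta -[zx q l * zy v l - _]mul1r -qc; ring.
Qed.

Lemma lambda_Psi c p v w :
  has_velocity c p v -> has_velocity (Psi \o c) (Psi p) w ->
  lambda (val (Psi p)) w = lambda (val p) v +
    2^-1 * (zx (val p) l ^+ 2 + zy (val p) l ^+ 2) * dtheta (val p) v.
Proof.
move=> cv cw; have [wx wy ws wa wb] := vel_Psi cv cw.
rewrite !lambdaE.
have -> : dtheta (val (Psi p)) w = dtheta (val p) v.
  by rewrite /dtheta wa wb.
have -> : wedge (val (Psi p)) w = wedge (val p) v +
    (zx (val p) l ^+ 2 + zy (val p) l ^+ 2) * dtheta (val p) v.
  exact: wedge_Psi (val_circle p) wx wy.
have -> : sc (val (Psi p)) = sc (val p) by [].
by ring.
Qed.

Lemma wedge_dil (r k r' : R) (q v w : amb) :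
  (forall j, zx w j = r * zx v j + zx q j * r') ->
  (forall j, zy w j = r * zy v j + zy q j * r') ->
  wedge (dil r k q) w = r ^+ 2 * wedge q v.
Proof.
move=> wx wy; rewrite /wedge mulr_sumr; apply: eq_bigr => j _.
by rewrite wx wy zx_dil zy_dil; ring.
Qed.

(** As [lambda] contains no [ds], the shear acts only through the coefficient of [d theta];
    renormalising multiplies by [kappa] because [lambda] has weight one. *)
Lemma lambda_shear t c p v w :
  has_velocity c p v -> has_velocity (shearM t \o c) (shearM t p) w ->
  lambda (val (shearM t p)) w = kappa (shear l t (val p)) *
    (lambda (val p) v - t * (zx (val p) l ^+ 2 + zy (val p) l ^+ 2) * dtheta (val p) v).
Proof.
move=> cv cw; have [r' [wx wy wa wb]] := vel_shear cv cw.
rewrite !lambdaE.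
have -> : dtheta (val (shearM t p)) w = dtheta (val p) v.
  by rewrite /dtheta wa wb.
have k0 := kappa_gt0 (rho_shear l t (set_valP p)).
have -> : wedge (val (shearM t p)) w = kappa (shear l t (val p)) * wedge (val p) v.
  have := @wedge_dil (Num.sqrt (kappa (shear l t (val p))))
    (kappa (shear l t (val p))) r' (shear l t (val p)) v w wx wy.
  by rewrite sqr_sqrtr ?ltW.
have -> : sc (val (shearM t p)) = kappa (shear l t (val p)) *
    (sc (val p) - t * (zx (val p) l ^+ 2 + zy (val p) l ^+ 2)) by [].
by ring.
Qed.

Lemma Diff_xi_Phi : Diff_xi (@Phi R n l).
Proof.
apply/Diff_xiP; split; first exact: Diff_Phi.
move=> c p v w cv cw.
have [L LE] := velocity_map p (Diff_Psi hl).1.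
have cu := LE _ _ cv.
have zn : zx (val (Psi p)) l ^+ 2 + zy (val (Psi p)) l ^+ 2 =
          zx (val p) l ^+ 2 + zy (val p) l ^+ 2.
  rewrite /= (zx_Psi hl) (zy_Psi hl) eqxx -[RHS]mul1r -(val_circle p); ring.
have th : dtheta (val (Psi p)) (L v) = dtheta (val p) v.
  by have [_ _ _ wa wb] := vel_Psi cv cu; rewrite /dtheta wa wb.
have cw' : has_velocity (shearM 2^-1 \o (Psi \o c)) (shearM 2^-1 (Psi p)) w by exact: cw.
have := @lambda_shear 2^-1 (Psi \o c) (Psi p) (L v) w cu cw'.
(* The term added by the twist and the term removed by the shear cancel, since [Psi] changes neither
   [|z_n|] nor [d theta]. A positive multiple of [lambda] remains. *)
rewrite (lambda_Psi cv cu) zn th addrK.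
have k0 := kappa_gt0 (rho_shear l 2^-1 (set_valP (Psi p))).
move=> wE; split=> [v0|w0]; first by rewrite [LHS]wE v0 mulr0.
by move: wE; rewrite [X in X = _ -> _]w0 => /esym/eqP; rewrite mulf_eq0 gt_eqF// => /eqP.
Qed.

End Velocities.

(** * Winding numbers *)

Section WindingNumber.
Context {R : realType}.
Implicit Types (f g : R -> R * R) (a : R -> R).
Local Notation T := (pi *+ 2 : R).

Lemma periodicz (U : Type) (f : R -> U) (k : int) t :
  (forall x, f (x + T) = f x) -> f (t + T * k%:~R) = f t.
Proof.
move=> fT.
have fTn m x : f (x + T * m%:R) = f x.
  elim: m x => [|m IH] x; first by rewrite mulr0 addr0.
  by rewrite -natr1 mulrDr mulr1 addrA fT IH.
case: k => m; first exact: fTn.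
by rewrite NegzE mulrNz mulrN -[LHS](fTn m.+1) subrK.
Qed.

(* As [a] is a periodic lift of the argument of [f / g], this quotient has
   winding number 0. *)
Definition same_winding f g := exists a,
  [/\ continuous a, forall x, a (x + T) = a x &
      forall x, exists2 r : R, 0 < r &
        f x = (r * ((g x).1 * cos (a x) - (g x).2 * sin (a x)),
               r * ((g x).1 * sin (a x) + (g x).2 * cos (a x)))].

Lemma same_winding_sym f g : same_winding f g -> same_winding g f.
Proof.
move=> [a [ca aT fg]]; exists (fun x => - a x); split.
- by move=> x; apply: continuousN; exact: ca.
- by move=> x; rewrite aT.
- move=> x; have [r r0 ->] := fg x; exists r^-1; first by rewrite invr_gt0.
  rewrite cosN sinN /=; have := cos2Dsin2 (a x).
  move: (cos _) (sin _) (g x) => c s [u v] cs /=.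
  have r1 : r^-1 * r = 1 by rewrite mulVf// gt_eqF.
  congr pair.
    transitivity (r^-1 * r * (u * (c ^+ 2 + s ^+ 2))); last by ring.
    by rewrite r1 cs mul1r mulr1.
  transitivity (r^-1 * r * (v * (c ^+ 2 + s ^+ 2))); last by ring.
  by rewrite r1 cs mul1r mulr1.
Qed.

Lemma same_winding_trans f g h :
  same_winding f g -> same_winding g h -> same_winding f h.
Proof.
move=> [a [ca aT fg]] [b [cb bT gh]]; exists (fun x => a x + b x); split.
- by move=> x; apply: continuousD; [exact: ca|exact: cb].
- by move=> x; rewrite aT bT.
- move=> x; have [r r0 ->] := fg x; have [s s0 ->] := gh x.
  exists (r * s); first by rewrite mulr_gt0.
  by rewrite cosD sinD /=; congr pair; ring.
Qed.

(** The product of [f] with the conjugate of [g] is [X + i Y]. Its real part being positive,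
    [atan (Y / X)] is a continuous argument of it, periodic because [f] and [g] are. *)
Lemma same_winding_close f g :
  continuous (fun x => (f x).1) -> continuous (fun x => (f x).2) ->
  continuous (fun x => (g x).1) -> continuous (fun x => (g x).2) ->
  (forall x, f (x + T) = f x) -> (forall x, g (x + T) = g x) ->
  (forall x, 0 < (f x).1 * (g x).1 + (f x).2 * (g x).2) -> same_winding f g.
Proof.
move=> cf1 cf2 cg1 cg2 fT gT fg0.
pose X x := (f x).1 * (g x).1 + (f x).2 * (g x).2.
pose Y x := (f x).2 * (g x).1 - (f x).1 * (g x).2.
exists (fun x => atan (Y x / X x)); split.
- move=> x; apply: continuous_comp; last exact: continuous_atan.
  apply: continuousM.
    by apply: continuousB; apply: continuousM;
      do ?[exact: cf1|exact: cf2|exact: cg1|exact: cg2].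
  apply: continuousV; first by rewrite gt_eqF// fg0.
  by apply: continuousD; apply: continuousM;
      do ?[exact: cf1|exact: cf2|exact: cg1|exact: cg2].
- by move=> x; rewrite /X /Y fT gT.
- move=> x; have X0 : 0 < X x := fg0 x.
  have w0 : 0 < cos (atan (Y x / X x)).
    by apply: cos_gt0_pihalf; rewrite atan_gtNpi2 atan_ltpi2.
  have := atanK (Y x / X x); rewrite /tan.
  move: (cos _) (sin _) w0 => w s w0 sE.
  have {sE} sE : s = Y x / X x * w by rewrite -sE divfK// gt_eqF.
  have g0 : 0 < (g x).1 ^+ 2 + (g x).2 ^+ 2.
    rewrite lt0r addr_ge0 ?sqr_ge0// andbT paddr_eq0 ?sqr_ge0// !sqrf_eq0.
    apply: contraL X0 => /andP[/eqP g1 /eqP g2].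
    by rewrite /X g1 g2 !mulr0 addr0 ltxx.
  (* From [f = (X + i Y) g / |g|^2] and [X + i Y = (X / w) e^(i a)], where [w = cos a]. *)
  exists (X x / (w * ((g x).1 ^+ 2 + (g x).2 ^+ 2))).
    by rewrite divr_gt0// mulr_gt0.
  rewrite sE; move: X0 g0; rewrite /X /Y.
  case: (f x) (g x) => [f1 f2] [g1 g2] /= X0 g0.
  by congr pair; field; rewrite !gt_eqF.
Qed.

Lemma same_winding_refl f : same_winding f f.
Proof.
exists (fun=> 0); split => // [x|x]; first exact: cst_continuous.
exists 1 => //; rewrite cos0 sin0 !mulr0 !mulr1 !mul1r subr0 add0r.
by case: (f x).
Qed.

(** By compactness of one period, the loops at nearby times have positive inner product everywhere.
    So the times with the winding of [h u] form an open and closed subset of the connected line. *)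
Lemma same_winding_homotopy (h : R -> R -> R * R) :
  continuous (fun p : R * R => (h p.1 p.2).1) ->
  continuous (fun p : R * R => (h p.1 p.2).2) ->
  (forall t x, h t (x + T) = h t x) ->
  (forall t x, h t x <> 0) ->
  forall t u, same_winding (h t) (h u).
Proof.
move=> c1 c2 hT h0 t u.
have T0 : 0 < T by rewrite mulrn_wgt0// pi_gt0.
have slice (k : R * R -> R) s : continuous k -> continuous (fun x => k (s, x)).
  move=> ck x; apply: (@continuous_comp _ _ _ (fun x => (s, x)) k).
    by apply: continuous_pair; [exact: cvg_cst|exact: cvg_id].
  exact: ck.
have loc s : \forall s' \near s, same_winding (h s') (h s).
  have /compact_near_coveringP cov := @segment_compact R 0 T.
  pose P s' x := 0 < (h s' x).1 * (h s x).1 + (h s' x).2 * (h s x).2.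
  have : \near s, `[0, T] `<=` P s.
    apply: (cov _ (nbhs s) P _) => x _.
    pose k (z : R * R) := (h z.2 z.1).1 * (h s z.1).1 + (h z.2 z.1).2 * (h s z.1).2.
    have ck : {for (x, s), continuous k}.
      have sw (m : R * R -> R) : continuous m ->
          continuous (fun z : R * R => m (z.2, z.1)).
        move=> cm z; apply: (@continuous_comp _ _ _ (fun z : R * R => (z.2, z.1)) m).
          by apply: continuous_pair; [exact: cvg_snd|exact: cvg_fst].
        exact: cm.
      have fs (m : R * R -> R) : continuous m ->
          continuous (fun z : R * R => m (s, z.1)).
        move=> cm z; apply: (@continuous_comp _ _ _ (fun z : R * R => (s, z.1)) m).
          by apply: continuous_pair; [exact: cvg_cst|exact: cvg_fst].
        exact: cm.
      apply: continuousD; apply: continuousM.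
      - exact: sw c1 _.
      - exact: fs c1 _.
      - exact: sw c2 _.
      - exact: fs c2 _.
    have k0 : 0 < k (x, s).
      rewrite /k /= lt0r -!expr2 addr_ge0 ?sqr_ge0// andbT.
      rewrite paddr_eq0 ?sqr_ge0// !sqrf_eq0; apply/negP => /andP[/eqP h1 /eqP h2].
      by apply: (h0 s x); move: h1 h2; case: (h s x) => ? ? /= -> ->.
    have : \forall z \near (x, s), 0 < k z by exact: (cvgr_gt _ ck _ k0).
    by apply: filterS => -[x' s'].
  apply: filterS => s' Ps'; apply: same_winding_close.
  - exact: (slice (fun p => (h p.1 p.2).1)).
  - exact: (slice (fun p => (h p.1 p.2).2)).
  - exact: (slice (fun p => (h p.1 p.2).1)).
  - exact: (slice (fun p => (h p.1 p.2).2)).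
  - exact: hT.
  - exact: hT.
  (* Removing the integer part of [x / T] many periods brings [x] into [[0, T]], where closeness is
     known. *)
  - move=> x; pose k := Num.floor (x / T).
    have := Ps' (x + T * (- k)%:~R); rewrite /P (periodicz _ _ (hT s')) (periodicz _ _ (hT s)); apply => /=.
    rewrite in_itv/= mulrNz mulrN subr_ge0 lerBlDr.
    have /andP[k1 k2] := floor_itv (x / T).
    rewrite mulrC -ler_pdivlMr// k1/=.
    by move: k2; rewrite ltr_pdivrMr// intrD mulrDl mul1r => /ltW; rewrite addrC.
pose S := [set s | same_winding (h s) (h u)].
have oS : open S.
  rewrite openE => s Ss; apply: filterS (loc s) => s' ss'.
  exact: same_winding_trans ss' Ss.
have cS : closed S.
  rewrite -[S]setCK; apply: open_closedC; rewrite openE => s nSs.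
  apply: filterS (loc s) => s' ss' Ss'; apply: nSs.
  exact: same_winding_trans (same_winding_sym ss') Ss'.
have RC : connected [set: R] by apply/connected_intervalP.
have ST : S = setT by apply: RC;
  [exists u; exact: same_winding_refl|exists S => //; rewrite setTI|
   exists S => //; rewrite setTI].
by have : S t by rewrite ST.
Qed.

(** The lift [b] satisfies [cos b = 1] everywhere; being continuous it cannot move, yet over one
    period it gains [T * (k - m)]. *)
Lemma winding_circle (k m : int) (C D : R) : 0 < C -> 0 < D ->
  same_winding (fun x => (C * cos (k%:~R * x), C * sin (k%:~R * x)))
               (fun x => (D * cos (m%:~R * x), D * sin (m%:~R * x))) -> k = m.
Proof.
move=> C0 D0 [a [ca aT h]].
pose b x := (k - m)%:~R * x - a x.
have b1 x : cos (b x) = 1.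
  have [r r0 []] := h x; rewrite /b intrB mulrBl.
  have -> : k%:~R * x - m%:~R * x - a x = k%:~R * x - (m%:~R * x + a x) by ring.
  have -> u v : D * cos u * cos v - D * sin u * sin v = D * cos (u + v).
    by rewrite cosD; ring.
  have -> u v : D * cos u * sin v + D * sin u * cos v = D * sin (u + v).
    by rewrite sinD; ring.
  rewrite cosB; move: (k%:~R * x) (_ + a x) => u v uv1 uv2.
  (* Comparing norms, [e^(i u) = q e^(i v)] with [q > 0] forces [q = 1]. *)
  have q0 : 0 < r * D / C by rewrite divr_gt0// mulr_gt0.
  have e1 : cos u = r * D / C * cos v.
    apply: (mulfI (lt0r_neq0 C0)); rewrite uv1; field; exact: lt0r_neq0.
  have e2 : sin u = r * D / C * sin v.
    apply: (mulfI (lt0r_neq0 C0)); rewrite uv2; field; exact: lt0r_neq0.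
  move: (r * D / C) q0 e1 e2 => q q0 e1 e2.
  have := cos2Dsin2 u; rewrite e1 e2 !exprMn -mulrDr cos2Dsin2 mulr1 => /eqP.
  rewrite sqrp_eq1 ?ltW// => /eqP q1.
  by rewrite q1 !mul1r -!expr2 cos2Dsin2.
have cb : continuous b.
  move=> x; apply: continuousB; last exact: ca.
  by apply: continuousM; [exact: cst_continuous|exact: cvg_id].
have bT : b T = b 0 + T * (k - m)%:~R.
  by rewrite /b -[T in a T]add0r aT; ring.
have T0 : 0 < T by rewrite mulrn_wgt0// pi_gt0.
have ivt v : Num.min (b 0) (b T) <= v <= Num.max (b 0) (b T) -> cos v = 1.
  move=> vI; have [|x _ <-] := @IVT R b 0 T v (ltW T0) _ vI; last exact: b1.
  exact: continuous_subspaceT.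
(* If [k] and [m] differ, [b] sweeps an interval of length at least [2 pi] starting at [b 0], hence
   meets [b 0 - pi] or [b 0 + pi], where the cosine is -1. *)
have [lt_km|lt_mk|//] := ltgtP k m.
- have : cos (b 0 - pi) = 1.
    apply: ivt; rewrite bT.
    have d : (k - m)%:~R <= -1 :> R.
      by rewrite -[-1]/((-1)%:~R) ler_int lerBlDr addrC -ltzD1 -addrA subrr addr0.
    have p0 := pi_gt0 R.
    have : T * (k - m)%:~R <= - T by rewrite -[- T]mulrN1 ler_pM2l.
    move: (T * _) => z; rewrite mulr2n => zT.
    by rewrite ge_min le_max; apply/andP; split; apply/orP; [right|left]; lra.
  by have := b1 0; move: (b 0) => z z1; rewrite cosB cospi sinpi z1 => e; exfalso; lra.
- have : cos (b 0 + pi) = 1.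
    apply: ivt; rewrite bT.
    have d : 1 <= (k - m)%:~R :> R.
      by rewrite -[1]/(1%:~R) ler_int -gtz0_ge1 subr_gt0.
    have p0 := pi_gt0 R.
    have : T <= T * (k - m)%:~R by rewrite ler_pMr.
    move: (T * _) => z; rewrite mulr2n => zT.
    by rewrite ge_min le_max; apply/andP; split; apply/orP; [left|right]; lra.
  by have := b1 0; move: (b 0) => z z1; rewrite cosD cospi sinpi z1 => e; exfalso; lra.
Qed.

End WindingNumber.

(** * Symmetry of second derivatives *)

Section SecondDerivatives.
Context {R : realType} {E : normedModType R}.
Implicit Types (phi : E -> R) (q u v : E).

Lemma smooth_at_dir (F : normedModType R) (f : E -> F) q u :
  smooth_at f q -> smooth_at (fun y => 'd f y u) q.
Proof.
move=> [U [oU Uq cf]]; exists U; split => // k.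
have [_ cTf] := cf k.+1.
have ci : Ck k U (fun y : E => (y, u)).
  apply: Ck_pair => //; last exact: Ck_cst.
  exact: Ck_clin oU (clin_id E).
have := Ck_comp (W := U `*` [set: E]) oU _ ci cTf.
move=> /(_ (fun y Uy => conj Uy I)).
exact: Ck_comp_clin oU (clin_snd F F).
Qed.

Lemma is_derive_line (F : normedModType R) (f : E -> F) q v t :
  differentiable f (q + t *: v) ->
  is_derive t (1 : R) (fun s => f (q + s *: v)) ('d f (q + t *: v) v).
Proof.
move=> df; have lv : is_derive t (1 : R) (fun s : R => q + s *: v) v.
  have := @is_deriveD _ _ _ (cst q) (fun s : R => s *: v) t 1 0 v.
  rewrite add0r; apply.
  have := is_derive_clin (is_derive_id t (1 : R)) (clin_scale_cst v).
  by rewrite scale1r.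
exact: (is_derive_diff_comp lv df).
Qed.

(** The second difference is an increment along [u] of an increment along [v]; the mean value
    theorem is applied once in each direction. *)
Lemma mean_value_square phi (h : R) q u v : (forall y, smooth_at phi y) -> 0 < h ->
  exists c d, [/\ 0 < c < h, 0 < d < h &
    phi (q + h *: u + h *: v) - phi (q + h *: u) - phi (q + h *: v) + phi q
    = h ^+ 2 * 'd (fun y => 'd phi y u) (q + c *: u + d *: v) v].
Proof.
move=> sphi h0.
have dphi y := smooth_at_diff (sphi y).
have ddphi y w := smooth_at_diff (smooth_at_dir w (sphi y)).
have mvt (k : R -> R) (dk : R -> R) : (forall x : R, is_derive x (1 : R) k (dk x)) ->
    exists2 c, 0 < c < h & k h - k 0 = dk c * h.
  move=> kd; have [|c] := @MVT _ k dk _ _ h0 (fun x _ => kd x).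
    apply: continuous_subspaceT => x.
    by apply: differentiable_continuous; apply/derivable1_diffP; exact: ex_derive.
  by rewrite in_itv/= subr0 => ch ->; exists c.
pose k a := phi ((q + h *: v) + a *: u) - phi (q + a *: u).
have [c ch kE] := mvt k _ (fun a => is_deriveB (is_derive_line (dphi _))
                                               (is_derive_line (dphi _))).
pose m b := 'd phi ((q + c *: u) + b *: v) u.
have [d dh mE] := mvt m _ (fun b => is_derive_line (ddphi _ u)).
exists c, d; split => //.
move: kE mE; rewrite /k /m !scale0r !addr0.
rewrite !(addrAC q (h *: v)) => kE mE.
transitivity ((phi (q + h *: u + h *: v) - phi (q + h *: u)) - (phi (q + h *: v) - phi q)).
  by ring.
by rewrite kE mE; ring.
Qed.

(** One second difference, divided by [h^2], is a value of either mixed derivative at a point near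
    [q]; both are continuous, and the square shrinks to [q]. *)
Lemma schwarz phi q u v : (forall y, smooth_at phi y) ->
  'd (fun y => 'd phi y u) q v = 'd (fun y => 'd phi y v) q u.
Proof.
move=> sphi.
pose P w w' (y : E) := 'd (fun y => 'd phi y w) y w'.
have cP w w' : {for q, continuous (P w w')}.
  apply: smooth_at_continuous; apply: smooth_at_dir; exact: smooth_at_dir.
apply/eqP; rewrite -subr_eq0 -normr_le0; apply/ler_addgt0Pr => e e0.
rewrite add0r.
have e2 : 0 < e / 2 by rewrite divr_gt0.
have near_small w w' : exists2 r : R, 0 < r &
    forall c d, 0 < c < r -> 0 < d < r -> `|P w w' q - P w w' (q + c *: u + d *: v)| < e / 2.
  have cm : {for (0, 0), continuous (fun z : R * R => P w w' (q + z.1 *: u + z.2 *: v))}.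
    apply: (@continuous_comp _ _ _ (fun z : R * R => q + z.1 *: u + z.2 *: v)).
      apply: smooth_at_continuous; apply: smooth_at_add.
        apply: smooth_at_add; first exact: smooth_at_cst.
        exact: smooth_at_clin (clin_comp (clin_fst R R) (clin_scale_cst u)).
      exact: smooth_at_clin (clin_comp (clin_snd R R) (clin_scale_cst v)).
    by rewrite /= !scale0r !addr0; exact: cP.
  move/cvgrPdist_lt : cm => /(_ _ e2) /=; rewrite !scale0r !addr0.
  move=> /nbhs_ballP[r /= r0 rP]; exists r => // c d /andP[c0 cr] /andP[d0 dr].
  apply: (rP (c, d)); split => /=; by rewrite /ball/= sub0r normrN gtr0_norm.
have [r1 r10 h1] := near_small u v.
have [r2 r20 h2] := near_small v u.
pose h := Num.min r1 r2 / 2.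
have h0 : 0 < h by rewrite divr_gt0// lt_min r10.
have hr1 : h < r1.
  by rewrite /h ltr_pdivrMr// (le_lt_trans (y := r1))// ?ge_min ?lexx// ltr_pMr// ltr1n.
have hr2 : h < r2.
  by rewrite /h ltr_pdivrMr// (le_lt_trans (y := r2))// ?ge_min ?lexx ?orbT// ltr_pMr// ltr1n.
have [c [d [/andP[c0 ch] /andP[d0 dh] E1]]] := mean_value_square q u v sphi h0.
have [c' [d' [/andP[c0' ch'] /andP[d0' dh'] E2]]] := mean_value_square q v u sphi h0.
have E12 : P u v (q + c *: u + d *: v) = P v u (q + d' *: u + c' *: v).
  have hh : h ^+ 2 != 0 by rewrite expf_neq0// gt_eqF.
  apply: (mulfI hh); rewrite -[LHS]E1 addrAC (addrAC q (d' *: u)) -[RHS]E2.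
  by rewrite (addrAC q (h *: v)); ring.
have := h1 c d; rewrite c0 d0 (lt_trans ch hr1) (lt_trans dh hr1) => /(_ isT isT) l1.
have := h2 d' c'; rewrite c0' d0' (lt_trans ch' hr2) (lt_trans dh' hr2) => /(_ isT isT) l2.
rewrite -/(P u v q) -/(P v u q).
have -> : P u v q - P v u q = (P u v q - P u v (q + c *: u + d *: v)) -
    (P v u q - P v u (q + d' *: u + c' *: v)) by rewrite E12; ring.
rewrite (splitr e); apply: le_trans (ler_normB _ _) _.
by apply: ltW; apply: ltrD.
Qed.

End SecondDerivatives.

(** * Complex frames along the pole *)

Section ComplexFrame.
Context {R : realType} {n : nat}.
Local Notation amb := (amb R n).
Local Notation Z := ('rV[R]_n * 'rV[R]_n)%type.
Implicit Types (p q v w : amb) (u : Z).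

(* [d lambda] evaluated on vectors tangent to V *)
Definition omega q v w :=
  \sum_(k < n) (zx v k * zy w k - zy v k * zx w k)
  + (sc v * dtheta q w - dtheta q v * sc w).

(** The standard symplectic form of C^n. *)
Definition sigma u u' : R := \sum_(k < n) (u.1 0 k * u'.2 0 k - u.2 0 k * u'.1 0 k).

(* With [C^(n+1)] carrying the coordinates [(z, s + i theta)], the rows are
   [w_j - i w'_j] and [X - i R], where [X = (z / 2, s)] is the Liouville
   direction at [q] and [R = (i z, i s)] is tangent to V, both being
   omega-orthogonal to the contact hyperplane. *)
Definition frame q (w w' : 'I_n -> amb) : 'M[R[i]]_(n + 1) :=
  block_mx
    (\matrix_(j, k) Complex (zx (w j) k + zy (w' j) k) (zy (w j) k - zx (w' j) k))
    (\col_j Complex (sc (w j) + dtheta q (w' j)) (dtheta q (w j) - sc (w' j)))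
    (\row_k Complex (3 / 2 * zx q k) (3 / 2 * zy q k))
    (const_mx (Complex (2 * sc q) 0)).

Lemma ReD (z1 z2 : R[i]) : complex.Re (z1 + z2) = complex.Re z1 + complex.Re z2.
Proof. by case: z1 z2 => [? ?] []. Qed.
Lemma ImD (z1 z2 : R[i]) : complex.Im (z1 + z2) = complex.Im z1 + complex.Im z2.
Proof. by case: z1 z2 => [? ?] []. Qed.
Lemma ReM (z1 z2 : R[i]) : complex.Re (z1 * z2) =
  complex.Re z1 * complex.Re z2 - complex.Im z1 * complex.Im z2.
Proof. by case: z1 z2 => [? ?] []. Qed.
Lemma ImM (z1 z2 : R[i]) : complex.Im (z1 * z2) =
  complex.Re z1 * complex.Im z2 + complex.Im z1 * complex.Re z2.
Proof. by case: z1 z2 => [? ?] []. Qed.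
Lemma Re_sum (I : Type) (r : seq I) (P : pred I) (F : I -> R[i]) :
  complex.Re (\sum_(i <- r | P i) F i) = \sum_(i <- r | P i) complex.Re (F i).
Proof. exact: (big_morph _ ReD). Qed.
Lemma Im_sum (I : Type) (r : seq I) (P : pred I) (F : I -> R[i]) :
  complex.Im (\sum_(i <- r | P i) F i) = \sum_(i <- r | P i) complex.Im (F i).
Proof. exact: (big_morph _ ImD). Qed.

Definition ex (j : 'I_n) : Z := (delta_mx 0 j, 0).
Definition ey (j : 'I_n) : Z := (0, delta_mx 0 j).

Lemma linear_coord_sum (L : Z -> R) (a b : 'rV[R]_n) : scalar L ->
  L (a, b) = \sum_(j < n) (a 0 j * L (ex j) + b 0 j * L (ey j)).
Proof.
move=> lL.
have rv (K : 'rV[R]_n -> R) (v : 'rV[R]_n) : scalar K ->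
    K v = \sum_(j < n) v 0 j * K (delta_mx 0 j).
  move=> lK; pose K' : {scalar 'rV[R]_n} := HB.pack K (GRing.isLinear.Build _ _ _ _ K lK).
  have KE : K = K' by [].
  rewrite {1}[v]row_sum_delta KE linear_sum; apply: eq_bigr => j _.
  by rewrite linearZ.
have L0 : L 0 = 0.
  by have := lL (-1) 0 0; rewrite scaler0 addr0 mulN1r addNr.
have -> : L (a, b) = L (a, 0) + L (0, b).
  have := lL 1 (a, 0) (0, b); rewrite mul1r scale1r => <-.
  by congr L; congr pair; rewrite ?addr0 ?add0r.
rewrite big_split /=; congr (_ + _).
  apply: (rv (fun r => L (r, 0))) => k r1 r2; rewrite -lL; congr L.
  by rewrite [RHS]surjective_pairing /= scaler0 addr0.
apply: (rv (fun r => L (0, r))) => k r1 r2; rewrite -lL; congr L.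
by rewrite [RHS]surjective_pairing /= scaler0 addr0.
Qed.

(** The letters [p] and [q] describe two vectors P and Q of the contact hyperplane, [ps], [qs] and
    [pt], [qt] being their [s] and [theta] components. Put P' = P + c X + d R and Q' = Q + c R - d
    X. As P and Q are orthogonal to X and R, the form on (P', Q') is [G] plus [c^2 + d^2] times its
    value [s^2 + |z|^2 / 2] on (X, R). The last four hypotheses say P' = i Q', so the form is also -
    |P'|^2. The constants 3/2 and 2 come from X - i R = (3 z / 2, 2 s). *)
Lemma frame_form_identity (x y px py qx qy : 'I_n -> R) (s ps pt qs qt c d G : R) :
  \sum_(k < n) (px k * qy k - py k * qx k) + (ps * qt - pt * qs) = G ->
  s * ps + \sum_(k < n) (x k * px k + y k * py k) = 0 ->
  s * qs + \sum_(k < n) (x k * qx k + y k * qy k) = 0 ->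
  s * pt + 2^-1 * \sum_(k < n) (x k * py k - y k * px k) = 0 ->
  s * qt + 2^-1 * \sum_(k < n) (x k * qy k - y k * qx k) = 0 ->
  (forall k, px k + qy k + (c * (3 / 2 * x k) - d * (3 / 2 * y k)) = 0) ->
  (forall k, py k - qx k + (c * (3 / 2 * y k) + d * (3 / 2 * x k)) = 0) ->
  ps + qt + c * (2 * s) = 0 -> pt - qs + d * (2 * s) = 0 ->
  G + (c ^+ 2 + d ^+ 2) * (s ^+ 2 + 2^-1 * \sum_(k < n) (x k ^+ 2 + y k ^+ 2)) <= 0.
Proof.
move=> GE tp tq lp lq hx hy hs ht.
pose px' k := px k + (c / 2 * x k - d * y k).
pose py' k := py k + (c / 2 * y k + d * x k).
pose qx' k := qx k + (- (d / 2) * x k - c * y k).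
pose qy' k := qy k + (- (d / 2) * y k + c * x k).
have e : \sum_(k < n) (px' k * qy' k - py' k * qx' k) +
    ((ps + c * s) * (qt + c * s) - (pt + d * s) * (qs - d * s)) =
    G + (c ^+ 2 + d ^+ 2) * (s ^+ 2 + 2^-1 * \sum_(k < n) (x k ^+ 2 + y k ^+ 2)).
  have -> : \sum_(k < n) (px' k * qy' k - py' k * qx' k) =
      \sum_(k < n) (px k * qy k - py k * qx k) +
      c * \sum_(k < n) (x k * px k + y k * py k) +
      d / 2 * \sum_(k < n) (x k * py k - y k * px k) +
      c / 2 * \sum_(k < n) (x k * qy k - y k * qx k) -
      d * \sum_(k < n) (x k * qx k + y k * qy k) +
      (c ^+ 2 + d ^+ 2) / 2 * \sum_(k < n) (x k ^+ 2 + y k ^+ 2).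
    rewrite -mulNr !mulr_sumr -!big_split /=; apply: eq_bigr => k _.
    by rewrite /px' /py' /qx' /qy'; field.
  move: GE tp tq lp lq; move: (\sum_(k < n) (px k * qy k - py k * qx k)).
  move: (\sum_(k < n) (x k * px k + y k * py k)).
  move: (\sum_(k < n) (x k * qx k + y k * qy k)).
  move: (\sum_(k < n) (x k * py k - y k * px k)).
  move: (\sum_(k < n) (x k * qy k - y k * qx k)).
  move: (\sum_(k < n) (x k ^+ 2 + y k ^+ 2)).
  move=> r A B C D F <- tp tq lp lq.
  have -> : D = - (s * ps) by apply/eqP; rewrite -subr_eq0 -tp; apply/eqP; ring.
  have -> : C = - (s * qs) by apply/eqP; rewrite -subr_eq0 -tq; apply/eqP; ring.
  have -> : B = - (2 * (s * pt)) by apply/eqP; rewrite -subr_eq0 -(mulr0 2) -lp; apply/eqP; field.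
  have -> : A = - (2 * (s * qt)) by apply/eqP; rewrite -subr_eq0 -(mulr0 2) -lq; apply/eqP; field.
  by field.
rewrite -e.
have qxE k : qx' k = py' k.
  by apply/eqP; rewrite -subr_eq0 -oppr_eq0 -(hy k); apply/eqP; rewrite /qx' /py'; field.
have qyE k : qy' k = - px' k.
  by apply/eqP; rewrite -subr_eq0 -(hx k); apply/eqP; rewrite /qy' /px'; field.
have -> : qt + c * s = - (ps + c * s).
  by apply/eqP; rewrite -subr_eq0 -hs; apply/eqP; ring.
have -> : qs - d * s = pt + d * s.
  by apply/eqP; rewrite -subr_eq0 -oppr_eq0 -ht; apply/eqP; ring.
rewrite -[leRHS]addr0; apply: lerD; last first.
  by rewrite mulrN -opprD oppr_le0 -!expr2 addr_ge0// sqr_ge0.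
apply: sumr_le0 => k _; rewrite qxE qyE.
by rewrite mulrN -opprD oppr_le0 -!expr2 addr_ge0// sqr_ge0.
Qed.

(** Where its complex linear part vanishes, a real linear map acts antilinearly and reverses the
    sign of the form on pairs (v, i v). Conformal symplecticity with [g > 0] forbids this on [u],
    and positivity of the form on (X, R) forbids it on the extra coefficient [e]. *)
Lemma frame_det_neq0 q (g : R) (M : Z -> amb) : linear M -> 0 < g ->
  (forall u, lambda q (M u) = 0) ->
  (forall u, sc q * sc (M u) +
     \sum_(k < n) (zx q k * zx (M u) k + zy q k * zy (M u) k) = 0) ->
  (forall u u', omega q (M u) (M u') = g * sigma u u') -> 0 < rho q ->
  \det (frame q (fun j => M (ex j)) (fun j => M (ey j))) != 0.
Proof.
move=> lM g0 Ml Mt Mo r0; apply/negP => /det0P[v vn0 vA].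
move: vn0 vA; rewrite -[v]hsubmxK; move: (lsubmx v) (rsubmx v) => u e vn0.
rewrite /frame mul_row_block.
move/eqP; rewrite -[X in _ == X]row_mx0 => /eqP/eq_row_mx[hz ht].
pose a : 'rV[R]_n := \row_j complex.Re (u 0 j).
pose b : 'rV[R]_n := \row_j complex.Im (u 0 j).
pose c := complex.Re (e 0 0); pose d := complex.Im (e 0 0).
have ML (L : amb -> R) : scalar L -> forall a b : 'rV[R]_n, L (M (a, b)) =
    \sum_(j < n) (a 0 j * L (M (ex j)) + b 0 j * L (M (ey j))).
  move=> lL a' b'; apply: (linear_coord_sum (L := fun u => L (M u))) => k u1 u2.
  by rewrite lM lL.
have Lth : scalar (dtheta q).
  move=> k v1 v2; rewrite /dtheta.
  have -> : ca (k *: v1 + v2) = k * ca v1 + ca v2 by exact: clin_ca.1.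
  have -> : cb (k *: v1 + v2) = k * cb v1 + cb v2 by exact: clin_cb.1.
  by ring.
have hzx k := ML _ (clin_zx k).1; have hzy k := ML _ (clin_zy k).1.
have hsc := ML _ (@clin_sc R n).1; have hth := ML _ Lth.
(* With [u = a + i b], the combination of the first [n] rows with coefficients [u] is P - i Q. *)
pose P := M (a, b); pose Q := M (- b, a).
have key : g * \sum_(j < n) (a 0 j ^+ 2 + b 0 j ^+ 2) +
   (c ^+ 2 + d ^+ 2) * (sc q ^+ 2 + 2^-1 * sqn q) <= 0.
  apply: (@frame_form_identity (zx q) (zy q) (zx P) (zy P) (zx Q) (zy Q)
    (sc q) (sc P) (dtheta q P) (sc Q) (dtheta q Q) c d) => [|||||k|k||].
  - transitivity (omega q P Q) => //; rewrite Mo /sigma; congr (_ * _).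
    by apply: eq_bigr => j _ /=; rewrite !mxE; ring.
  - exact: Mt.
  - exact: Mt.
  - exact: Ml.
  - exact: Ml.
  - have /(congr1 (@complex.Re R)) := congr1 (fun A : 'rV[R[i]]_n => A 0 k) hz.
    rewrite !mxE big_ord1 ReD Re_sum ReM !mxE /= => <-.
    rewrite !hzx !hzy -big_split /=; congr (_ + _).
    by apply: eq_bigr => j _; rewrite ReM !mxE /=; ring.
  - have /(congr1 (@complex.Im R)) := congr1 (fun A : 'rV[R[i]]_n => A 0 k) hz.
    rewrite !mxE big_ord1 ImD Im_sum ImM !mxE /= => <-.
    rewrite !hzx !hzy -sumrB /=; congr (_ + _).
    by apply: eq_bigr => j _; rewrite ImM !mxE /=; ring.
  - have /(congr1 (@complex.Re R)) := congr1 (fun A : 'rV[R[i]]_1 => A 0 0) ht.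
    rewrite !mxE big_ord1 ReD Re_sum ReM !mxE /= mulr0 subr0 => <-.
    rewrite hsc hth -big_split /=; congr (_ + _).
    by apply: eq_bigr => j _; rewrite ReM !mxE /=; ring.
  - have /(congr1 (@complex.Im R)) := congr1 (fun A : 'rV[R[i]]_1 => A 0 0) ht.
    rewrite !mxE big_ord1 ImD Im_sum ImM !mxE /= mulr0 add0r => <-.
    rewrite hsc hth -sumrB /=; congr (_ + _).
    by apply: eq_bigr => j _; rewrite ImM !mxE /=; ring.
have X0 : 0 < sc q ^+ 2 + 2^-1 * sqn q.
  move: r0; rewrite rho_gt0 => /orP[s0|s0].
    by rewrite ltr_wpDl ?sqr_ge0// mulr_gt0// invr_gt0.
  by rewrite ltr_wpDr ?exprn_even_gt0// mulr_ge0 ?sqn_ge0// invr_ge0.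
have S0 : 0 <= \sum_(j < n) (a 0 j ^+ 2 + b 0 j ^+ 2).
  by apply: sumr_ge0 => j _; rewrite addr_ge0// sqr_ge0.
have cd0 : 0 <= c ^+ 2 + d ^+ 2 by rewrite addr_ge0// sqr_ge0.
have gS0 := mulr_ge0 (ltW g0) S0; have cdX0 := mulr_ge0 cd0 (ltW X0).
have /eqP : g * \sum_(j < n) (a 0 j ^+ 2 + b 0 j ^+ 2) +
   (c ^+ 2 + d ^+ 2) * (sc q ^+ 2 + 2^-1 * sqn q) = 0.
  by apply/eqP; rewrite eq_le key addr_ge0.
rewrite paddr_eq0// !mulf_eq0 (gt_eqF g0) (gt_eqF X0) orbF /=.
rewrite paddr_eq0 ?sqr_ge0// !sqrf_eq0 => /andP[/eqP S /andP[/eqP c0 /eqP d0]].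
move/eqP: vn0; apply.
have -> : e = 0.
  apply/matrixP => i j; rewrite !ord1 mxE.
  by move: c0 d0; rewrite /c /d; case: (e 0 0) => ? ? /= -> ->.
have -> : u = 0.
  apply/rowP => j; rewrite mxE.
  have : a 0 j ^+ 2 + b 0 j ^+ 2 = 0.
    move/eqP: S; rewrite psumr_eq0; last by move=> i _; rewrite addr_ge0// sqr_ge0.
    by move=> /allP/(_ j (mem_index_enum j))/eqP.
  move=> /eqP; rewrite paddr_eq0 ?sqr_ge0// !sqrf_eq0 !mxE => /andP[].
  by case: (u 0 j) => ? ? /= /eqP -> /eqP ->.
by rewrite row_mx0.
Qed.

End ComplexFrame.

(** * The derivative along the pole *)

Section PoleChart.
Context {R : realType} {n : nat}.
Local Notation V := (V R n).
Local Notation amb := (amb R n).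
Local Notation Z := ('rV[R]_n * 'rV[R]_n)%type.
Implicit Types (f : V -> V) (u : Z) (y w : Z * R).

(** The slice [s = 1], transverse to the dilations near the pole, with the angle unrolled to the
    line. *)
Definition lift_amb y : amb := ((y.1, 1), (cos y.2, sin y.2)).

Definition chart_amb y : amb := nrm (lift_amb y).

Lemma rho_lift y : 0 < rho (lift_amb y).
Proof. by rewrite rho_gt0 /sc /= oner_eq0 orbT. Qed.

Lemma chart_ambV y : Defs.V R n (chart_amb y).
Proof. by apply: nrmV; [exact: rho_lift|exact: cos2Dsin2]. Qed.

Definition chart y : V := mkV (chart_ambV y).

Definition pole (th : R) : V := chart (0, th).

Lemma smooth_at_lift y : smooth_at lift_amb y.
Proof.
have s2 : smooth_at (fun x : Z * R => x.2) y by exact/smooth_at_snd/smooth_at_id.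
apply: smooth_at_pair; last exact: smooth_at_pair (smooth_at_cos s2) (smooth_at_sin s2).
by apply: smooth_at_pair; [exact/smooth_at_fst/smooth_at_id|exact: smooth_at_cst].
Qed.

Lemma smooth_at_chart y : smooth_at chart_amb y.
Proof. exact: smooth_at_nrm (smooth_at_lift y) (rho_lift y). Qed.

Lemma kappa_pole th : kappa (lift_amb (0, th)) = 1.
Proof.
apply: kappa_unique => //; rewrite !mul1r /sc /= expr1n.
rewrite /sqn big1 ?addr0// => j _.
by rewrite /zx /zy /= mxE expr0n addr0.
Qed.

Lemma val_pole th : val (pole th) = lift_amb (0, th).
Proof.
rewrite /= /chart_amb /nrm kappa_pole sqrtr1.
by apply: amb_eq => [j|j||//|//]; rewrite ?zx_dil ?zy_dil ?sc_dil mul1r.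
Qed.

Lemma chart_velocity y w :
  has_velocity (fun t => chart (y + t *: w)) (chart y) ('d chart_amb y w).
Proof.
split; first by rewrite scale0r addr0.
have := @is_derive_line _ _ _ chart_amb y w 0.
rewrite scale0r addr0; apply; exact/smooth_at_diff/smooth_at_chart.
Qed.

Lemma chart_velocity_coord y w : exists r', [/\
  forall j, zx ('d chart_amb y w) j = Num.sqrt (kappa (lift_amb y)) * w.1.1 0 j + y.1.1 0 j * r',
  forall j, zy ('d chart_amb y w) j = Num.sqrt (kappa (lift_amb y)) * w.1.2 0 j + y.1.2 0 j * r',
  ca ('d chart_amb y w) = - sin y.2 * w.2 & cb ('d chart_amb y w) = cos y.2 * w.2].
Proof.
have cv := chart_velocity y w.
pose r := fun x : Z * R => Num.sqrt (kappa (lift_amb x)).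
have sr : smooth_at r y.
  apply: smooth_at_sqrt; first exact/kappa_gt0/rho_lift.
  exact: smooth_at_kappa (smooth_at_lift y) (rho_lift y).
have rv := @is_derive_line _ _ _ r y w 0; rewrite scale0r addr0 in rv.
have {}rv := rv (smooth_at_diff sr).
have line (k : Z * R -> R) : clin k -> is_derive (0 : R) (1 : R) (fun t : R => k (y + t *: w)) (k w).
  move=> lk; have := @is_derive_line _ _ _ k y w 0.
  by rewrite scale0r addr0 (clin_diff y lk).2; apply; exact: (clin_diff y lk).1.
have lx j := clin_comp (clin_comp (clin_fst _ R) (clin_fst 'rV[R]_n 'rV[R]_n)) (clin_coord 0 j).
have ly j := clin_comp (clin_comp (clin_fst _ R) (clin_snd 'rV[R]_n 'rV[R]_n)) (clin_coord 0 j).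
have lt := line _ (clin_snd Z R).
exists ('d r y w); split.
- move=> j; apply: is_derive_uniq (vel_zx cv j) _.
  under eq_fun do rewrite /= zx_dil.
  by have := der_mul rv (line _ (lx j)); rewrite !scale0r !addr0.
- move=> j; apply: is_derive_uniq (vel_zy cv j) _.
  under eq_fun do rewrite /= zy_dil.
  by have := der_mul rv (line _ (ly j)); rewrite !scale0r !addr0.
- apply: is_derive_uniq (vel_ca cv) _.
  have dc : differentiable (@cos R) ((fun t : R => (y + t *: w).2) 0).
    by apply/derivable1_diffP; exact: derivable_cos.
  have := is_derive_diff_comp lt dc.
  rewrite deriv1E; last exact: derivable_cos.
  by rewrite derive1E derive_val /= scale0r addr0 mulrC.
- apply: is_derive_uniq (vel_cb cv) _.
  have dc : differentiable (@sin R) ((fun t : R => (y + t *: w).2) 0).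
    by apply/derivable1_diffP; exact: derivable_sin.
  have := is_derive_diff_comp lt dc.
  rewrite deriv1E; last exact: derivable_sin.
  by rewrite derive1E derive_val /= scale0r addr0 mulrC.
Qed.

(** On the slice [lambda] is [d theta + r^2 d phi / 2]; flowing to V multiplies it by [kappa],
    whatever the derivative [r'] of the scaling factor. *)
Lemma lambda_chart y w : lambda (chart_amb y) ('d chart_amb y w) =
  kappa (lift_amb y) * (w.2 + 2^-1 * sigma y.1 w.1).
Proof.
have [r' [wx wy wa wb]] := chart_velocity_coord y w.
rewrite lambdaE.
have -> : dtheta (chart_amb y) ('d chart_amb y w) = w.2.
  rewrite /dtheta wa wb -[RHS]mul1r -(cos2Dsin2 y.2).
  by rewrite [ca _](_ : _ = cos y.2)// [cb _](_ : _ = sin y.2)//; ring.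
have -> : wedge (chart_amb y) ('d chart_amb y w) = kappa (lift_amb y) * sigma y.1 w.1.
  have := @wedge_dil _ _ _ (kappa (lift_amb y)) r' (lift_amb y) ((w.1, 0), (0, 0)) _ wx wy.
  by rewrite sqr_sqrtr// ltW// kappa_gt0// rho_lift.
have -> : sc (chart_amb y) = kappa (lift_amb y) by rewrite /chart_amb sc_dil mulr1.
by ring.
Qed.

(** Read in the chart, [f] becomes a map between normed spaces, to which ['d] applies; [f] itself
    lives on V only. *)
Definition through f y : amb := val (f (chart y)).

Lemma smooth_at_through f y : smooth_map f -> smooth_at (through f) y.
Proof.
move=> sf; have [U [G [oU Uy cG GE]]] := sf (chart y).
apply: (smooth_at_eq (f := fun x => G (chart_amb x))).
  have cc := smooth_at_continuous (smooth_at_chart y).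
  near=> x; apply: (GE (chart x)); change (U (chart_amb x)).
  by near: x; apply: cc; exact: open_nbhs_nbhs.
apply: smooth_at_comp (smooth_at_chart y) _.
by exists U.
Unshelve. all: by end_near. Qed.

Lemma through_velocity f y w : smooth_map f ->
  has_velocity (f \o (fun t => chart (y + t *: w))) (f (chart y)) ('d (through f) y w).
Proof.
move=> sf; split; first by rewrite /= scale0r addr0.
have := @is_derive_line _ _ _ (through f) y w 0.
by rewrite scale0r addr0; apply; exact/smooth_at_diff/smooth_at_through.
Qed.

Lemma lambda_through f y w : Diff_xi f ->
  lambda (through f y) ('d (through f) y w) = 0 <-> w.2 + 2^-1 * sigma y.1 w.1 = 0.
Proof.
move=> /Diff_xiP[[sf _] lf].
have := lf _ _ _ _ (chart_velocity y w) (through_velocity y w sf).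
rewrite -/(through f y) => <-; rewrite lambda_chart.
have k0 := kappa_gt0 (rho_lift y).
split=> [/eqP|->]; last by rewrite mulr0.
by rewrite mulf_eq0 gt_eqF// => /eqP.
Qed.

End PoleChart.

(** * Conformal symplecticity along the pole *)

Section ContactTwoForm.
Context {R : realType} {n : nat}.
Local Notation V := (V R n).
Local Notation amb := (amb R n).
Local Notation Z := ('rV[R]_n * 'rV[R]_n)%type.

Lemma diff_clin_comp (E F G : normedModType R) (f : E -> F) (k : F -> G) y w :
  clin k -> differentiable f y -> 'd (fun x => k (f x)) y w = k ('d f y w).
Proof.
move=> lk df; have [dk kE] := clin_diff (f y) lk.
by rewrite (diff_comp df dk) /= kE.
Qed.

Section SecondOrder.
Variables (E : normedModType R) (F : E -> amb) (sF : forall y, smooth_at F y).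
Variables (y d e : E).

Let D k x v : R := 'd (fun y => k (F y)) x v.
Let D2 k := 'd (fun x => D k x d) y e.

(** The product rule, arranged so that the second derivatives [D2], symmetric in [d] and [e], stand
    apart from the products of first derivatives, which will give [d lambda]. *)
Lemma der_lambda_along :
  is_derive (0 : R) (1 : R)
    (fun t : R => lambda (F (y + t *: e)) ('d F (y + t *: e) d))
    (sc (F y) * (ca (F y) * D2 (@cb R n) - cb (F y) * D2 (@ca R n)
                 + (ca ('d F y e) * cb ('d F y d) - cb ('d F y e) * ca ('d F y d)))
     + dtheta (F y) ('d F y d) * sc ('d F y e)
     + 2^-1 * \sum_(k < n)
         ((zx (F y) k * D2 (fun p => zy p k) - zy (F y) k * D2 (fun p => zx p k))
          + (zx ('d F y e) k * zy ('d F y d) k - zy ('d F y e) k * zx ('d F y d) k))).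
Proof.
have dF x := smooth_at_diff (sF x).
have h0 (k : amb -> R) : clin k ->
    is_derive (0 : R) (1 : R) (fun t : R => k (F (y + t *: e))) (k ('d F y e)).
  move=> lk; have := @is_derive_line _ _ _ (fun x => k (F x)) y e 0.
  rewrite scale0r addr0 diff_clin_comp//; apply.
  exact: smooth_at_diff (smooth_at_comp (sF y) (smooth_at_clin _ lk)).
have h1 (k : amb -> R) : clin k ->
    is_derive (0 : R) (1 : R) (fun t : R => k ('d F (y + t *: e) d)) (D2 k).
  move=> lk; have := @is_derive_line _ _ _ (fun x => D k x d) y e 0.
  rewrite scale0r addr0.
  have -> : (fun s : R => D k (y + s *: e) d) = (fun s => k ('d F (y + s *: e) d)).
    by apply/funext => s; exact: diff_clin_comp.
  apply; apply/smooth_at_diff/smooth_at_dir.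
  exact: smooth_at_comp (sF y) (smooth_at_clin _ lk).
have ha := clin_ca (R := R) (n := n); have hb := clin_cb (R := R) (n := n).
have hs := clin_sc (R := R) (n := n).
have hx k := clin_zx (R := R) (n := n) k; have hy k := clin_zy (R := R) (n := n) k.
have hth := der_sub (der_mul (h0 _ ha) (h1 _ hb)) (der_mul (h0 _ hb) (h1 _ ha)).
have hw := der_sum (fun k => der_sub (der_mul (h0 _ (hx k)) (h1 _ (hy k)))
                                     (der_mul (h0 _ (hy k)) (h1 _ (hx k)))).
have := der_add (der_mul (h0 _ hs) hth) (der_scale 2^-1 hw).
rewrite /= scale0r addr0 => h; apply: is_derive_eq h _.
have rearr (r1 r2 r3 r4 r5 r6 r7 r8 : R) :
    r1 * r2 + r3 * r4 - (r5 * r6 + r7 * r8) =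
    r1 * r2 - r5 * r6 + (r4 * r3 - r8 * r7) by ring.
congr (_ + _ + 2^-1 * _); first by congr (_ * _); exact: rearr.
by apply: eq_bigr => k _; exact: rearr.
Qed.

End SecondOrder.

Lemma lambda_sub (p v w : amb) (k : R) :
  lambda p (v - k *: w) = lambda p v - k * lambda p w.
Proof.
have coord (L : amb -> R) : clin L -> L (v - k *: w) = L v - k * L w.
  move=> [lL _]; rewrite addrC -scaleNr.
  have -> : L (- k *: w + v) = - k * L w + L v by exact: lL.
  by rewrite mulNr addrC.
rewrite !lambdaE /dtheta (coord _ clin_ca) (coord _ clin_cb).
have -> : wedge p (v - k *: w) = wedge p v - k * wedge p w.
  rewrite /wedge mulr_sumr -sumrB; apply: eq_bigr => j _.
  by rewrite (coord _ (clin_zx j)) (coord _ (clin_zy j)); ring.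
by ring.
Qed.

(** At [(t e, th)] the vector [(d, - t sigma e d / 2)] lies in the contact plane. Differentiating
    [lambda = 0] on its image at [t = 0] gives [main]; exchanging [d] and [e] and subtracting
    removes the symmetric second derivatives and leaves [d lambda]. *)
Lemma omega_through (f : V -> V) th (u u' : Z) : Diff_xi f ->
  omega (through f (0, th)) ('d (through f) (0, th) (u, 0))
                            ('d (through f) (0, th) (u', 0)) =
  lambda (through f (0, th)) ('d (through f) (0, th) (0, 1)) * sigma u u'.
Proof.
move=> fxi; have [[smf _] _] := (Diff_xiP f).1 fxi.
set F := through f; set y := ((0, th) : Z * R).
have sF x : smooth_at F x by exact: smooth_at_through.
pose g := lambda (F y) ('d F y (0, 1)).
pose D2 (k : amb -> R) (d e : Z * R) := 'd (fun x => 'd (fun z => k (F z)) x d) y e.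
have D2C k d e : clin k -> D2 k d e = D2 k e d.
  move=> lk; apply: schwarz => x.
  exact: smooth_at_comp (sF x) (smooth_at_clin _ lk).
pose A d e := sc (F y) * (ca (F y) * D2 (@cb R n) d e - cb (F y) * D2 (@ca R n) d e)
  + 2^-1 * \sum_(k < n) (zx (F y) k * D2 (fun p => zy p k) d e
                         - zy (F y) k * D2 (fun p => zx p k) d e).
have AC d e : A d e = A e d.
  rewrite /A (D2C _ _ _ clin_ca) (D2C _ _ _ clin_cb); congr (_ + _ * _).
  by apply: eq_bigr => k _; rewrite (D2C _ _ _ (clin_zx k)) (D2C _ _ _ (clin_zy k)).
pose B d e := \sum_(k < n) (zx ('d F y e) k * zy ('d F y d) k
                            - zy ('d F y e) k * zx ('d F y d) k).
have circ (e : Z * R) : ca (F y) * ca ('d F y e) + cb (F y) * cb ('d F y e) = 0.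
  exact: (velocity_V (through_velocity y e smf)).2.
have oneC : ca (F y) ^+ 2 + cb (F y) ^+ 2 = 1 by exact: val_circle.
(* Both velocities are tangent to the circle, hence parallel: the differential of [d theta]
   contributes nothing. *)
have par (d e : Z * R) :
    ca ('d F y e) * cb ('d F y d) - cb ('d F y e) * ca ('d F y d) = 0.
  have := circ d; have := circ e.
  move: (ca ('d F y e)) (cb ('d F y e)) (ca ('d F y d)) (cb ('d F y d)).
  move: (ca (F y)) (cb (F y)) oneC => a b ab a1 b1 a2 b2 h1 h2.
  rewrite -[LHS]mul1r -ab.
  transitivity ((a * a1 + b * b1) * (a * b2 - b * a2)
    - (a * b1 - b * a1) * (a * a2 + b * b2)); first by ring.
  by rewrite h1 h2 mul0r mulr0 subr0.
have main (d e : Z) : A (d, 0) (e, 0) + dtheta (F y) ('d F y (d, 0)) * sc ('d F y (e, 0))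
    + 2^-1 * B (d, 0) (e, 0) = 2^-1 * sigma e d * g.
  have h1 : is_derive (0 : R) (1 : R)
      (fun t : R => lambda (F (y + t *: (e, 0))) ('d F (y + t *: (e, 0)) (d, 0)))
      (A (d, 0) (e, 0) + dtheta (F y) ('d F y (d, 0)) * sc ('d F y (e, 0))
       + 2^-1 * B (d, 0) (e, 0)).
    apply: is_derive_eq (@der_lambda_along _ F sF y (d, 0) (e, 0)) _.
    have aux (s p q t x w : R) : q = 0 ->
      s * (p + q) + t + 2^-1 * (x + w) = s * p + 2^-1 * x + t + 2^-1 * w.
      by move=> ->; ring.
    by rewrite [X in _ + _ * X = _]big_split; exact: (aux _ _ _ _ _ _ (par _ _)).
  (* [V2] may stay unknown: it enters multiplied by [sigma e d * t / 2] at [t = 0]. *)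
  have [V2 h2] : exists V2, is_derive (0 : R) (1 : R)
      (fun t : R => lambda (F (y + t *: (e, 0))) ('d F (y + t *: (e, 0)) (0, 1))) V2.
    by eexists; exact: (@der_lambda_along _ F sF y (0, 1) (e, 0)).
  have h3 : is_derive (0 : R) (1 : R) (fun t : R => 2^-1 * sigma e d * t) (2^-1 * sigma e d * 1).
    exact: der_scale (is_derive_id _ _).
  have h := der_sub h1 (der_mul h3 h2).
  rewrite /= scale0r addr0 -/g in h.
  have z t : sigma (y + t *: ((e, 0) : Z * R)).1 d = t * sigma e d.
    have -> : (y + t *: ((e, 0) : Z * R)).1 = t *: e by rewrite /= add0r.
    rewrite /sigma mulr_sumr; apply: eq_bigr => k _.
    by rewrite /= !mxE; ring.
  have h0 : (fun t : R => lambda (F (y + t *: (e, 0))) ('d F (y + t *: (e, 0)) (d, 0))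
     - 2^-1 * sigma e d * t
       * lambda (F (y + t *: (e, 0))) ('d F (y + t *: (e, 0)) (0, 1))) = cst 0.
    apply/funext => t /=.
    rewrite -lambda_sub -linearZ -linearB.
    apply: (lambda_through _ _ fxi).2.
    set w : Z * R := (d, 0) - _.
    have -> : w.1 = d by rewrite /w /= scaler0 subr0.
    have -> : w.2 = - (2^-1 * sigma e d * t) by rewrite /w /= sub0r; congr (- _); exact: mulr1.
    by rewrite z; ring.
  rewrite h0 in h.
  have := is_derive_uniq h (is_derive_cst _ _ _).
  move: (_ + _ + _) => W; rewrite mulr0 mul0r add0r mulr1.
  by move/eqP; rewrite subr_eq0 => /eqP ->; rewrite mulrC.
have := main u' u; rewrite (AC (u', 0)); have := main u u'.
have sC : sigma u u' = - sigma u' u.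
  by rewrite /sigma -sumrN; apply: eq_bigr => k _; ring.
have BC : B (u', 0) (u, 0) = - B (u, 0) (u', 0).
  by rewrite /B -sumrN; apply: eq_bigr => k _; ring.
rewrite sC BC -/g /omega -/(B (u', 0) (u, 0)) BC.
rewrite (mulrC (sc ('d F y (u, 0)))).
move: (A _ _) (B _ _) (dtheta _ _ * _) (dtheta _ _ * _) => a b m1 m2 e1 e2.
transitivity ((a + m1 + 2^-1 * - b) - (a + m2 + 2^-1 * b)); first by field.
by rewrite e1 e2; field.
Qed.

End ContactTwoForm.

(** * Powers of the twist at the pole *)

Section PoleRotation.
Context {R : realType} {n : nat} (l : 'I_n) (hl : l.+1 = n).
Local Notation V := (V R n).
Local Notation amb := (amb R n).
Local Notation Z := ('rV[R]_n * 'rV[R]_n)%type.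
Local Notation pole := (@pole R n).
Implicit Types (f g : V -> V) (c : R -> V) (v w : amb).

(** The differential at the pole, on velocities of V. The component [sc] is not listed because it
    vanishes on all of them there. *)
Definition rotated (x : R) v w := [/\
  forall j, zx w j = if j == l then cos x * zx v l - sin x * zy v l else zx v j,
  forall j, zy w j = if j == l then sin x * zx v l + cos x * zy v l else zy v j,
  ca w = ca v & cb w = cb v].

Definition rotates f (k : int) := (forall th, f (pole th) = pole th) /\
  forall th c v w, has_velocity c (pole th) v ->
    has_velocity (f \o c) (pole th) w -> rotated (k%:~R * th) v w.

Lemma rotated_trans x y v w u :
  rotated x v w -> rotated y w u -> rotated (x + y) v u.
Proof.
move=> [wx wy wa wb] [ux uy ua ub]; split; rewrite ?ua ?ub//.
- by move=> j; rewrite ux !wx wy eqxx; case: eqP => // _; rewrite cosD sinD; ring.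
- by move=> j; rewrite uy !wy wx eqxx; case: eqP => // _; rewrite cosD sinD; ring.
Qed.

Lemma rotated_sym x v w : rotated x v w -> rotated (- x) w v.
Proof.
move=> [wx wy wa wb]; have cs := cos2Dsin2 x; split; rewrite ?wa ?wb//.
- move=> j; rewrite wx wy eqxx cosN sinN !wx; case: eqP => // ->.
  by rewrite -[LHS]mul1r -cs; ring.
- move=> j; rewrite wx !wy eqxx cosN sinN; case: eqP => // ->.
  by rewrite -[LHS]mul1r -cs; ring.
Qed.

Lemma rotates_id : rotates id 0.
Proof.
split=> // th c v w cv cw; rewrite mul0r.
have <- : v = w by exact: is_derive_uniq cv.2 cw.2.
split=> // j; rewrite cos0 sin0 !mul1r mul0r ?subr0 ?add0r; case: eqP => // -> //.
Qed.

Lemma rotates_comp f g k m : smooth_map f ->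
  rotates f k -> rotates g m -> rotates (g \o f) (k + m).
Proof.
move=> sf [fp fr] [gp gr]; split=> [th|th c v w cv cw]; first by rewrite /= fp gp.
have [L LE] := velocity_map (pole th) sf.
have cL := LE _ _ cv; rewrite fp in cL.
rewrite intrD mulrDl; apply: rotated_trans (fr _ _ _ _ cv cL) _.
exact: gr cL cw.
Qed.

Lemma rotates_inv f g k : cancel f g -> cancel g f -> rotates f k -> rotates g (- k).
Proof.
move=> fg gf [fp fr]; have gp th : g (pole th) = pole th by rewrite -{1}(fp th) fg.
split=> // th c v w cv cw; rewrite mulrNz mulNr; apply: rotated_sym.
apply: (fr th (g \o c)) => //.
have -> // : f \o (g \o c) = c by apply/funext => t /=; rewrite gf.
Qed.

Lemma zx_pole th j : zx (val (pole th)) j = 0.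
Proof. by rewrite val_pole /zx /= mxE. Qed.
Lemma zy_pole th j : zy (val (pole th)) j = 0.
Proof. by rewrite val_pole /zy /= mxE. Qed.
Lemma ca_pole th : ca (val (pole th)) = cos th. Proof. by []. Qed.
Lemma cb_pole th : cb (val (pole th)) = sin th. Proof. by []. Qed.
Lemma sc_pole th : sc (val (pole th)) = 1.
Proof. by rewrite val_pole. Qed.

Lemma Psi_pole th : @Psi R n (pole th) = pole th.
Proof.
apply: val_inj; apply: amb_eq => // j.
  by rewrite [LHS](zx_Psi hl) !zx_pole zy_pole !mulr0 subr0 if_same.
by rewrite [LHS](zy_Psi hl) zx_pole !zy_pole !mulr0 addr0 if_same.
Qed.

Lemma shear_pole t th : shear l t (val (pole th)) = val (pole th).
Proof.
apply: amb_eq => //; rewrite {1}/sc /= -/(sc _).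
by rewrite -!/(val (pole th)) zx_pole zy_pole expr0n addr0 mulr0 subr0.
Qed.

Lemma kappa_val_pole th : kappa (val (pole th)) = 1.
Proof. exact: (V_kappa (set_valP (pole th))).2. Qed.

Lemma shearM_pole t th : shearM l t (pole th) = pole th.
Proof.
apply: val_inj; rewrite /= -/(val (pole th)).
have -> : nrm (shear l t (val (pole th))) = val (pole th); last by [].
rewrite shear_pole /nrm kappa_val_pole sqrtr1.
by apply: amb_eq => [j|j||//|//]; rewrite ?zx_dil ?zy_dil ?sc_dil mul1r.
Qed.

Lemma rotates_Psi : rotates (@Psi R n) 1.
Proof.
split=> [th|th c v w cv cw]; first exact: Psi_pole.
rewrite -(Psi_pole th) in cw.
have [wx wy ws wa wb] := vel_Psi hl cv cw; rewrite mul1r.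
split=> // j; rewrite ?wx ?wy !zx_pole !zy_pole !mul0r !addr0 ca_pole cb_pole.
  by [].
by [].
Qed.

(** The shear is quadratic in [z], and [kappa] is 1 on the pole circle, so to first order there
    nothing turns. *)
Lemma rotates_shear t : rotates (shearM l t) 0.
Proof.
split=> [th|th c v w cv cw]; first exact: shearM_pole.
rewrite -(shearM_pole t th) in cw.
have [r' [wx wy wa wb]] := vel_shear cv cw; rewrite mul0r.
rewrite shear_pole kappa_val_pole sqrtr1 in wx wy.
split=> // j; rewrite ?wx ?wy ?zx_pole ?zy_pole cos0 sin0 !mul1r !mul0r addr0 ?subr0 ?add0r;
  by case: eqP => // ->.
Qed.

Lemma rotates_Phi : rotates (@Phi R n l) 1.
Proof.
rewrite -[1]addr0; apply: rotates_comp (Diff_Psi hl).1 rotates_Psi (rotates_shear _).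
Qed.

Lemma inv_mapE f g : cancel f g -> cancel g f -> inv_map f = g.
Proof.
move=> fg gf; apply/funext => q; rewrite /inv_map.
have := @xgetI _ q [set p | f p = q] (g q) (gf q) => /= h.
by rewrite -[LHS]fg h.
Qed.

Lemma iter_ind_comp (P : (V -> V) -> int -> Prop) f k :
  P id 0 -> (forall g m, P g m -> P (f \o g) (m + k)) ->
  forall m, P (iter m f) (m%:Z * k).
Proof.
move=> P0 PS; elim=> [|m IH]; first by rewrite mul0r.
by have := PS _ _ IH; rewrite intS mulrDl mul1r addrC.
Qed.

(** [P] carries an exponent, so one induction serves both the properties that ignore it (with
    [k = 0]) and the count of turns. *)
Lemma zpow_ind (P : (V -> V) -> int -> Prop) f g k :
  cancel f g -> cancel g f -> P id 0 ->
  (forall h m, P h m -> P (f \o h) (m + k)) ->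
  (forall h m, P h m -> P (g \o h) (m - k)) ->
  forall m, P (zpow f m) (m * k).
Proof.
move=> fg gf P0 Pf Pg [m|m] /=; first exact: iter_ind_comp.
rewrite (inv_mapE fg gf) NegzE mulNr -mulrN.
exact: (@iter_ind_comp P g (- k) P0 Pg m.+1).
Qed.

Definition Phi2 : V -> V := Phi l \o Phi l.
Definition Phi2I : V -> V := PhiI l \o PhiI l.

Lemma Phi2K : cancel Phi2 Phi2I.
Proof. exact: can_comp (PhiK hl) (PhiK hl). Qed.
Lemma Phi2IK : cancel Phi2I Phi2.
Proof. exact: can_comp (PhiIK hl) (PhiIK hl). Qed.

Lemma Diff_xi_Phi2 : Diff_xi Phi2.
Proof. by apply: Diff_xi_comp; exact: Diff_xi_Phi. Qed.

Lemma Diff_xi_Phi2I : Diff_xi Phi2I.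
Proof. exact: Diff_xi_inv Diff_xi_Phi2 Phi2K Phi2IK. Qed.

Lemma Diff_xi_zpow (m : int) : Diff_xi (zpow Phi2 m).
Proof.
have := @zpow_ind (fun f _ => Diff_xi f) _ _ 0 Phi2K Phi2IK Diff_xi_id.
apply=> h _ hh; apply: Diff_xi_comp hh _; [exact: Diff_xi_Phi2|exact: Diff_xi_Phi2I].
Qed.

Lemma rotates_Phi2 : rotates Phi2 2.
Proof.
apply: (@rotates_comp _ _ 1 1); [exact: (Diff_Phi hl).1|exact: rotates_Phi|exact: rotates_Phi].
Qed.

Lemma rotates_zpow (m : int) : rotates (zpow Phi2 m) (m * 2).
Proof.
suff [_ //] : smooth_map (zpow Phi2 m) /\ rotates (zpow Phi2 m) (m * 2).
apply: (@zpow_ind (fun f k => smooth_map f /\ rotates f k) _ _ 2 Phi2K Phi2IK).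
- by split; [exact: smooth_map_id|exact: rotates_id].
- move=> h k [sh rh]; split; first exact: smooth_map_comp sh Diff_xi_Phi2.1.1.
  exact: rotates_comp sh rh rotates_Phi2.
- move=> h k [sh rh]; split; first exact: smooth_map_comp sh Diff_xi_Phi2I.1.1.
  exact: rotates_comp sh rh (rotates_inv Phi2K Phi2IK rotates_Phi2).
Qed.

Lemma isotopic_zpow_id (m : int) : isotopic Diff (zpow Phi2 m) id.
Proof.
have D2 := Diff_xi_Phi2.1; have D2I := Diff_xi_Phi2I.1.
have i2 : isotopic Diff Phi2 id by exact: isotopic_Phi2_id.
have i2I : isotopic Diff Phi2I id.
  have := isotopic_comp i2 (isotopic_refl D2I D2I.1).
  rewrite (_ : Phi2I \o Phi2 = id); last by apply/funext => x; exact: Phi2K.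
  exact: isotopic_sym.
have := @zpow_ind (fun f _ => isotopic Diff f id) _ _ 0 Phi2K Phi2IK.
apply; first by apply: isotopic_refl; [exact: Diff_id|exact: smooth_map_id].
- by move=> h _ hh; have := isotopic_comp hh i2.
- by move=> h _ hh; have := isotopic_comp hh i2I.
Qed.

End PoleRotation.

(** * The determinant along the pole *)

Section FrameAlongPole.
Context {R : realType} {n : nat} (l : 'I_n).
Local Notation V := (V R n).
Local Notation amb := (amb R n).
Local Notation Z := ('rV[R]_n * 'rV[R]_n)%type.
Local Notation pole := (@pole R n).
Implicit Types (f g : V -> V).

(** At [z = 0] the contact plane of the chart consists of the vectors [(u, 0)]; the remaining
    complex direction is supplied by the last row of [frame]. *)
Definition pole_frame f th : 'M[R[i]]_(n + 1) :=
  frame (through f (0, th))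
    (fun j => 'd (through f) (0, th) (ex j, 0))
    (fun j => 'd (through f) (0, th) (ey j, 0)).

(** In the chart [lambda] takes the value 1 on [(0, 1)] at the pole, so this is the factor by which
    [f] multiplies [lambda] there. *)
Definition pole_factor f th : R :=
  lambda (through f (0, th)) ('d (through f) (0, th) (0, 1)).

Lemma pole_factor_neq0 f th : Diff_xi f -> pole_factor f th != 0.
Proof.
move=> fxi; apply/eqP => /(lambda_through _ _ fxi) /= /eqP.
rewrite /sigma big1 ?mulr0 ?addr0 ?oner_eq0// => j _.
by rewrite !mxE !mul0r subr0.
Qed.

Lemma pole_frame_det_neq0 f th : Diff_xi f -> 0 < pole_factor f th ->
  \det (pole_frame f th) != 0.
Proof.
move=> fxi g0; have [[smf _] _] := (Diff_xiP f).1 fxi.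
apply: (@frame_det_neq0 _ _ (through f (0, th)) (pole_factor f th)
  (fun u => 'd (through f) (0, th) (u, 0))) => //.
- move=> a u v; rewrite -linearP; congr ('d (through f) (0, th) _).
  by rewrite [RHS]surjective_pairing /= scaler0 addr0.
- move=> u; apply/(lambda_through _ _ fxi) => /=.
  rewrite add0r /sigma big1 ?mulr0// => j _.
  by rewrite !mxE !mul0r subr0.
- by move=> u; exact: (velocity_V (through_velocity (0, th) (u, 0) smf)).1.
- by move=> u u'; exact: omega_through.
- exact: (V_kappa (set_valP (f (chart (0, th))))).1.
Qed.

Lemma through_pole_rotated f k th (w : Z * R) : smooth_map f -> rotates l f k ->
  [/\ rotated l (k%:~R * th) ('d (@chart_amb R n) (0, th) w) ('d (through f) (0, th) w),
      through f (0, th) = val (pole th) & sc ('d (through f) (0, th) w) = 0].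
Proof.
move=> sf [fp fr].
have cv := chart_velocity (0, th) w; have cw := through_velocity (0, th) w sf.
rewrite -/(pole th) in cv; rewrite -/(pole th) fp in cw.
split; [exact: fr cv cw|by rewrite /through -/(pole th) fp|].
have [+ _] := velocity_V cw; rewrite sc_pole mul1r big1 ?addr0// => j _.
by rewrite zx_pole zy_pole !mul0r addr0.
Qed.

Lemma pole_factor_rotates f k th : smooth_map f -> rotates l f k ->
  pole_factor f th = 1.
Proof.
move=> sf fr; have [[_ _ wa wb] qE _] := through_pole_rotated th (0, 1) sf fr.
rewrite /pole_factor qE lambdaE sc_pole /dtheta wa wb ca_pole cb_pole.
have [_ [_ _ -> ->]] := chart_velocity_coord (0, th) ((0, 1) : Z * R).
rewrite /wedge big1; last by move=> j _; rewrite zx_pole zy_pole !mul0r subr0.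
by rewrite /= -[RHS](cos2Dsin2 th); ring.
Qed.

(** The differential is complex linear here, so each row [w_j - i w'_j] is twice the image of a
    basis vector. The matrix is diagonal with entries 2, except [2 e^(i k th)] at [l]; the corner is
    [2 s = 2]. *)
Lemma det_pole_frame_rotates f k : smooth_map f -> rotates l f k ->
  exists2 K : R, 0 < K & forall th, \det (pole_frame f th) =
    Complex (K * cos (k%:~R * th)) (K * sin (k%:~R * th)).
Proof.
move=> sf fr.
have [K K0 KE] : exists2 K : R, 0 < K &
    \prod_(j < n | j != l) Complex 2 0 = Complex K 0 :> R[i].
  apply: (big_ind (fun z => exists2 K : R, 0 < K & z = Complex K 0)).
  - by exists 1.
  - move=> _ _ [a a0 ->] [b b0 ->]; exists (a * b); first exact: mulr_gt0.
    by congr Complex; rewrite ?mulr0 ?mul0r ?subr0 ?addr0.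
  - by move=> _ _; exists 2.
(* [K] collects the entries with [j != l]; the entry at [l] and the corner contribute a factor 2
   each. *)
exists (K * 4) => [|th]; first by rewrite mulr_gt0.
set x := k%:~R * th.
have coord u (w := 'd (through f) (0, th) ((u, 0) : Z * R)) : [/\
    forall j, zx w j = if j == l then cos x * u.1 0 l - sin x * u.2 0 l else u.1 0 j,
    forall j, zy w j = if j == l then sin x * u.1 0 l + cos x * u.2 0 l else u.2 0 j,
    sc w = 0 & dtheta (through f (0, th)) w = 0].
  have [[wx wy wa wb] qE ws] := through_pole_rotated th ((u, 0) : Z * R) sf fr.
  have [r' [vx vy va vb]] := chart_velocity_coord (0, th) ((u, 0) : Z * R).
  split; [| |exact: ws|].
  - by move=> j; rewrite wx !vx !vy kappa_pole sqrtr1 /= !mxE !mul0r !addr0 !mul1r.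
  - by move=> j; rewrite wy !vx !vy kappa_pole sqrtr1 /= !mxE !mul0r !addr0 !mul1r.
  - by rewrite /dtheta wa wb va vb /= !mulr0 subr0.
have -> : pole_frame f th = block_mx
    (diag_mx (\row_j (if j == l then Complex (2 * cos x) (2 * sin x) else Complex 2 0)))
    0 0 (const_mx (Complex 2 0)).
  rewrite /pole_frame /frame; congr block_mx; last 3 first.
  - by apply/colP => j; rewrite !mxE; have [_ _ -> _] := coord (ex j);
      have [_ _ -> _] := coord (ey j); have [_ _ _ ->] := coord (ex j);
      have [_ _ _ ->] := coord (ey j); rewrite addr0 subr0.
  - have [_ -> _] := through_pole_rotated th (0 : Z * R) sf fr.
    by apply/rowP => j; rewrite !mxE zx_pole zy_pole !mulr0.
  - have [_ -> _] := through_pole_rotated th (0 : Z * R) sf fr.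
    by rewrite sc_pole mulr1.
  - apply/matrixP => i j; rewrite !mxE.
    have [ax ay _ _] := coord (ex i); have [bx by' _ _] := coord (ey i).
    rewrite ax ay bx by' /= !mxE /=.
    case: (i =P j) => [<-|/eqP ij]; last first.
      rewrite mulr0n; case: (j =P l) => [jl|_].
        subst j; rewrite eq_sym (negbTE ij) !mulr0 subr0 addr0; congr Complex; ring.
      by rewrite eq_sym (negbTE ij) addr0 subr0.
    rewrite mulr1n eqxx; case: (i =P l) => [->|_].
      by rewrite !eqxx /=; congr Complex; ring.
    by rewrite /=; congr Complex; ring.
rewrite det_ublock det_diag (bigD1 l)//= mxE eqxx det_mx11 mxE.
under eq_bigr => j jl do rewrite mxE (negbTE jl).
by rewrite KE; congr Complex; rewrite /=; ring.
Qed.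

End FrameAlongPole.

(** * Continuity along a contact isotopy *)

Section Continuity.
Context {R : realType} {n : nat} (l : 'I_n).
Local Notation V := (V R n).
Local Notation amb := (amb R n).
Local Notation Z := ('rV[R]_n * 'rV[R]_n)%type.
Implicit Types (f g : V -> V) (H : R -> V -> V).

(* Clamping the time makes a path over [0, 1] a path over the whole line. *)
Definition clamp (t : R) : R := Num.max 0 (Num.min 1 t).

Lemma clamp01 t : 0 <= clamp t <= 1.
Proof.
rewrite /clamp le_max lexx /= ge_max ler01 /=.
by rewrite ge_min lexx.
Qed.

Lemma clamp_id t : 0 <= t <= 1 -> clamp t = t.
Proof. by move=> /andP[t0 t1]; rewrite /clamp min_r// max_r. Qed.

Lemma clamp_le0 t : t <= 0 -> clamp t = 0.
Proof. by move=> t0; rewrite /clamp max_l// ge_min t0 orbT. Qed.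

Lemma clamp_continuous : continuous clamp.
Proof.
move=> t; apply: (@continuous_max R R (cst 0) (fun t => Num.min 1 t) t).
  exact: cst_continuous.
apply: (@continuous_min R R (cst 1) id t); first exact: cst_continuous.
exact: cvg_id.
Qed.

(** The tangent map of [K] is jointly continuous, so continuity of [a] suffices; clamped time is not
    differentiable. *)
Lemma continuous_diff_dir (E F X : normedModType R) (U : set E) (K : E -> F)
    (a b : X -> E) x : open U -> Cinf U K -> U (a x) ->
  {for x, continuous a} -> {for x, continuous b} ->
  {for x, continuous (fun z => 'd K (a z) (b z))}.
Proof.
move=> oU cK Uax ca cb.
have [_ cTK] := cK 1%N.
have := continuous_comp (continuous_pair ca cb) (cTK (a x, b x) (conj Uax I)).
move=> h; exact: (continuous_comp h (@cvg_snd _ _ _ _ _)).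
Qed.

Lemma through_family_continuous H (w : Z * R) : smooth_family H ->
  continuous (fun p : R * R => through (H (clamp p.1)) (0, p.2)) /\
  continuous (fun p : R * R => 'd (through (H (clamp p.1))) (0, p.2) w).
Proof.
move=> sH.
suff both p0 : {for p0, continuous (fun p : R * R => through (H (clamp p.1)) (0, p.2))} /\
   {for p0, continuous (fun p : R * R => 'd (through (H (clamp p.1))) (0, p.2) w)}.
  by split=> p0; have [] := both p0.
have cl01 t : clamp t \in `[(0 : R), 1]%classic by rewrite inE /= in_itv/= clamp01.
pose s t : `[(0 : R), 1]%classic := SigSub (cl01 t).
have [U [K [oU Up0 cK KE]]] := sH (s p0.1, pole p0.2).
have {}KE t q : U (clamp t, val q) -> K (clamp t, val q) = val (H (clamp t) q).
  by move=> Utq; exact: (KE (s t, q)).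
pose base (p : R * R) := ((clamp p.1, chart_amb (0, p.2)) : R * amb).
have cth : {for p0, continuous (fun p : R * R => ((0 : Z, p.2) : Z * R))}.
  by apply: continuous_pair; [exact: cst_continuous|exact: cvg_snd].
have cbase : {for p0, continuous base}.
  apply: continuous_pair.
    by apply: continuous_comp; [exact: cvg_fst|exact: clamp_continuous].
  apply: (continuous_comp cth).
  exact: smooth_at_continuous (smooth_at_chart _).
have nearU : \forall p \near p0, U (base p).
  by apply: cbase; exact: open_nbhs_nbhs.
have cchart : {for p0, continuous
    (fun p : R * R => ((0 : R, 'd (@chart_amb R n) (0, p.2) w) : R * amb))}.
  apply: continuous_pair; first exact: cst_continuous.
  apply: (continuous_comp cth (g := fun y => 'd (@chart_amb R n) y w)).
  exact: smooth_at_continuous (smooth_at_dir _ (smooth_at_chart _)).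
split.
- have cKb : {for p0, continuous (fun p => K (base p))}.
    apply: (continuous_comp cbase).
    exact: Ck_continuous (cK 0%N) Up0.
  apply: continuous_near_eq cKb; apply: filterS nearU => p Up.
  exact: (KE p.1 (chart (0, p.2))).
- have cdK := continuous_diff_dir oU cK Up0 cbase cchart.
  have dE p : U (base p) -> 'd K (base p) (0, 'd (@chart_amb R n) (0, p.2) w)
      = 'd (through (H (clamp p.1))) (0, p.2) w.
    move=> Up.
    have dch := smooth_at_diff (smooth_at_chart ((0, p.2) : Z * R)).
    have dK : differentiable K (base p) by case: (cK 1%N) => /(_ _ Up).
    (* [inc] freezes the time, so the differential of the extension [K] is taken only in directions
       along V. *)
    pose inc (y : Z * R) : R * amb := (clamp p.1, chart_amb y).
    have dcst := @differentiable_cst R (Z * R)%type R (clamp p.1) (0, p.2).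
    have din : differentiable inc (0, p.2) := differentiable_pair dcst dch.
    have dinE v : 'd inc (0, p.2) v = (0, 'd (@chart_amb R n) (0, p.2) v).
      by rewrite (diff_pair dcst dch) diff_cst.
    have nearE : \forall y \near ((0, p.2) : Z * R),
        (K \o inc) y = through (H (clamp p.1)) y.
      have : \forall y \near ((0, p.2) : Z * R), U (inc y).
        by apply: (differentiable_continuous din); exact: open_nbhs_nbhs.
      by apply: filterS => y Uy; exact: (KE p.1 (chart y)).
    have dcomp : differentiable (K \o inc) (0, p.2) := differentiable_comp din dK.
    have [_ thE] := diff_near_eq nearE dcomp.
    have cE : 'd (K \o inc) (0, p.2) w = 'd K (base p) ('d inc (0, p.2) w).
      exact: (congr1 (fun h => h w) (diff_comp din dK)).
    rewrite -dinE -cE.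
    exact: (esym (congr1 (fun h : Z * R -> amb => h w) thE)).
  by apply: continuous_near_eq cdK; apply: filterS nearU => p /dE.
Qed.

Section RealContinuity.
Variables (X : topologicalType) (a b : X -> R).
Hypotheses (ca : continuous a) (cb : continuous b).

Lemma continuous_add : continuous (fun x => a x + b x).
Proof. by move=> x; apply: (@continuousD R R); [exact: ca|exact: cb]. Qed.
Lemma continuous_sub : continuous (fun x => a x - b x).
Proof. by move=> x; apply: (@continuousB R R); [exact: ca|exact: cb]. Qed.
Lemma continuous_mul : continuous (fun x => a x * b x).
Proof. by move=> x; apply: continuousM; [exact: ca|exact: cb]. Qed.
End RealContinuity.

Lemma continuous_sum_ord (X : topologicalType) m (a : 'I_m -> X -> R) :
  (forall j, continuous (a j)) -> continuous (fun x => \sum_(j < m) a j x).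
Proof.
move=> ca; elim: (index_enum _) => [|j r IH].
  by under eq_fun do rewrite big_nil; move=> x; exact: cst_continuous.
under eq_fun do rewrite big_cons.
exact: continuous_add.
Qed.

(** Stated by components, the form in which [same_winding_homotopy] takes its hypotheses. *)
Definition continuousC (X : topologicalType) (h : X -> R[i]) :=
  continuous (fun x => complex.Re (h x)) /\ continuous (fun x => complex.Im (h x)).

Lemma continuousC_det (X : topologicalType) m (A : X -> 'M[R[i]]_m) :
  (forall i j, continuousC (fun x => A x i j)) -> continuousC (fun x => \det (A x)).
Proof.
move=> cA.
have ccst (a : R[i]) : continuousC (fun _ : X => a).
  by split=> x; exact: cst_continuous.
have cadd (f g : X -> R[i]) : continuousC f -> continuousC g ->
    continuousC (fun x => f x + g x).
  move=> [f1 f2] [g1 g2]; split.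
    have -> : (fun x => complex.Re (f x + g x)) =
        (fun x => complex.Re (f x) + complex.Re (g x)) by apply/funext => x; rewrite ReD.
    exact: continuous_add.
  have -> : (fun x => complex.Im (f x + g x)) =
      (fun x => complex.Im (f x) + complex.Im (g x)) by apply/funext => x; rewrite ImD.
  exact: continuous_add.
have cmul (f g : X -> R[i]) : continuousC f -> continuousC g ->
    continuousC (fun x => f x * g x).
  move=> [f1 f2] [g1 g2]; split.
    have -> : (fun x => complex.Re (f x * g x)) = (fun x => complex.Re (f x) *
        complex.Re (g x) - complex.Im (f x) * complex.Im (g x)).
      by apply/funext => x; rewrite ReM.
    by apply: continuous_sub; exact: continuous_mul.
  have -> : (fun x => complex.Im (f x * g x)) = (fun x => complex.Re (f x) *
      complex.Im (g x) + complex.Im (f x) * complex.Re (g x)).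
    by apply/funext => x; rewrite ImM.
  by apply: continuous_add; exact: continuous_mul.
have cbig (op : R[i] -> R[i] -> R[i]) (idx : R[i]) (I : Type) (r : seq I) (h : I -> X -> R[i]) :
    (forall f g : X -> R[i], continuousC f -> continuousC g ->
       continuousC (fun x => op (f x) (g x))) ->
    (forall i, continuousC (h i)) ->
    continuousC (fun x => \big[op/idx]_(i <- r) h i x).
  move=> cop ch; elim: r => [|i r IH].
    by under eq_fun do rewrite big_nil; exact: ccst.
  by under eq_fun do rewrite big_cons; exact: cop.
apply: (cbig) => // s; apply: (cmul); first exact: ccst.
by apply: (cbig) => [f g fc gc|i]; [exact: cmul|exact: cA].
Qed.

Lemma pole_frame_continuous H : smooth_family H ->
  continuousC (fun p : R * R => \det (pole_frame (H (clamp p.1)) p.2)).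
Proof.
move=> sH; apply: continuousC_det => i j.
have cq := (through_family_continuous 0 sH).1.
have cw u := (through_family_continuous ((u, 0) : Z * R) sH).2.
have lin (L : amb -> R) (v : R * R -> amb) : clin L -> continuous v ->
    continuous (fun p => L (v p)).
  by move=> [_ cL] cv p; apply: (continuous_comp (cv p)); exact: cL.
have zxc k := lin _ _ (clin_zx k); have zyc k := lin _ _ (clin_zy k).
have scc := lin _ _ clin_sc.
have cth u : continuous (fun p : R * R => dtheta (through (H (clamp p.1)) (0, p.2))
    ('d (through (H (clamp p.1))) (0, p.2) ((u, 0) : Z * R))).
  apply: continuous_sub; apply: continuous_mul.
  - exact: (lin _ _ clin_ca cq).
  - exact: (lin _ _ clin_cb (cw u)).
  - exact: (lin _ _ clin_cb cq).
  - exact: (lin _ _ clin_ca (cw u)).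
have cc (r : R) : continuous (fun _ : R * R => r) by move=> p; exact: cst_continuous.
rewrite /pole_frame /frame.
case: (split_ordP i) => i' ->; case: (split_ordP j) => j' ->.
- under eq_fun do rewrite block_mxEul mxE.
  split; first exact: (continuous_add (zxc _ j' (cw (ex i'))) (zyc _ j' (cw (ey i')))).
  exact: (continuous_sub (zyc _ j' (cw (ex i'))) (zxc _ j' (cw (ey i')))).
- under eq_fun do rewrite block_mxEur mxE.
  split; first exact: (continuous_add (scc _ (cw (ex i'))) (cth (ey i'))).
  exact: (continuous_sub (cth (ex i')) (scc _ (cw (ey i')))).
- under eq_fun do rewrite block_mxEdl mxE.
  split; first exact: (continuous_mul (cc (3 / 2)) (zxc _ j' cq)).
  exact: (continuous_mul (cc (3 / 2)) (zyc _ j' cq)).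
- under eq_fun do rewrite block_mxEdr mxE.
  split; last exact: cc.
  exact: (continuous_mul (cc 2) (scc _ cq)).
Qed.

(** A continuous factor without zeros that starts at 1 stays positive. The sign matters: with a
    negative factor the complex linear part could be singular, as it is for complex conjugation. *)
Lemma pole_factor_gt0 H k : smooth_family H -> rotates l (H 0) k ->
  (forall t : R, 0 <= t <= 1 -> Diff_xi (H t)) ->
  forall t th, 0 < pole_factor (H (clamp t)) th.
Proof.
move=> sH r0 Hxi t th.
pose g s := pole_factor (H (clamp s)) th.
have cg : continuous g.
  have cq := (through_family_continuous 0 sH).1.
  have cw := (through_family_continuous ((0, 1) : Z * R) sH).2.
  have lin (L : amb -> R) (v : R * R -> amb) : clin L -> continuous v ->
      continuous (fun s => L (v (s, th))).
    move=> [_ cL] cv s; apply: (@continuous_comp _ _ _ (fun s => v (s, th)) L).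
      apply: (@continuous_comp _ _ _ (fun s : R => (s, th)) v); last exact: cv.
      by apply: continuous_pair; [exact: cvg_id|exact: cst_continuous].
    exact: cL.
  have cc (r : R) : continuous (fun _ : R => r) by move=> s; exact: cst_continuous.
  apply: continuous_add.
    apply: continuous_mul; first exact: (lin _ _ clin_sc cq).
    by apply: continuous_sub; apply: continuous_mul;
      [exact: (lin _ _ clin_ca cq)|exact: (lin _ _ clin_cb cw)
      |exact: (lin _ _ clin_cb cq)|exact: (lin _ _ clin_ca cw)].
  apply: continuous_mul; first exact: cc.
  apply: continuous_sum_ord => j; apply: continuous_sub; apply: continuous_mul.
  - exact: (lin _ _ (clin_zx j) cq).
  - exact: (lin _ _ (clin_zy j) cw).
  - exact: (lin _ _ (clin_zy j) cq).
  - exact: (lin _ _ (clin_zx j) cw).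
have g0 : 0 < g 0.
  rewrite /g clamp_id ?lexx ?ler01//.
  by rewrite (pole_factor_rotates _ _ r0)//; case: (Hxi 0); rewrite ?lexx ?ler01// => -[].
have gn0 s : g s != 0 by apply: pole_factor_neq0; apply: Hxi; exact: clamp01.
(* For [t <= 0] clamping freezes the factor at its initial value; for [t > 0] a sign change would
   produce a zero. *)
have [t0|t0] := leP t 0; first by have := g0; rewrite /g !clamp_le0.
rewrite ltNge; apply/negP => gt0.
have gI : Num.min (g 0) (g t) <= 0 <= Num.max (g 0) (g t).
  move: g0 gt0; rewrite -/(g t); move: (g 0) (g t) => a b a0 b0.
  by rewrite ge_min le_max b0 (ltW a0) orbT.
have [s _ gs] := @IVT R g 0 t 0 (ltW t0) (continuous_subspaceT cg) gI.
by have := gn0 s; rewrite [X in X != 0]gs eqxx.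
Qed.


End Continuity.

(** * Infinite order of the squared twist *)

Section InfiniteOrder.
Context {R : realType} {n : nat} (l : 'I_n) (hl : l.+1 = n).
Local Notation V := (V R n).
Local Notation Z := ('rV[R]_n * 'rV[R]_n)%type.

Lemma through_periodic (f : V -> V) (z : Z) th :
  through f (z, th + pi *+ 2) = through f (z, th).
Proof.
rewrite /through; congr (val (f _)); apply: val_inj => /=.
by rewrite /chart_amb /lift_amb /= cosD2pi sinD2pi.
Qed.

Lemma pole_frame_periodic (f : V -> V) th : smooth_map f ->
  pole_frame f (th + pi *+ 2) = pole_frame f th.
Proof.
move=> sf.
have dE w : 'd (through f) (0, th + pi *+ 2) w = 'd (through f) (0, th) w.
  have line (y : Z * R) := @is_derive_line _ _ _ (through f) y w 0.
  have h1 := line (0, th + pi *+ 2); rewrite scale0r addr0 in h1.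
  have h2 := line (0, th); rewrite scale0r addr0 in h2.
  have d1 := h1 (smooth_at_diff (smooth_at_through _ sf)).
  have d2 := h2 (smooth_at_diff (smooth_at_through _ sf)).
  have shiftE (s : R) : through f ((0, th) + s *: w) =
      through f ((0, th + pi *+ 2) + s *: w).
    rewrite -through_periodic; congr (through f _).
    by congr pair; rewrite /= addrAC.
  have d3 := near_eq_is_derive (nearW (F := nbhs (0 : R)) _ shiftE) d2.
  exact: (is_derive_uniq d1 (d3 _)).
have dEfun (k : 'I_n -> Z) : (fun j => 'd (through f) (0, th + pi *+ 2) (k j, 0)) =
    (fun j => 'd (through f) (0, th) (k j, 0)) by apply/funext => j; exact: dE.
exact: (f_equal3 (@frame R n) (through_periodic f 0 th) (dEfun _) (dEfun _)).
Qed.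

(** The determinants along the path form a homotopy of loops avoiding 0, between loops that turn
    [2 k] and [2 m] times. *)
Lemma isotopic_zpow_inj (k m : int) :
  isotopic Diff_xi (zpow (@Phi2 R n l) k) (zpow (Phi2 l) m) -> k = m.
Proof.
move=> [H [sH Hxi H0 H1]].
have smH t : smooth_map (H (clamp t)) by case: (Hxi _ (clamp01 t)) => -[].
pose D t th := \det (pole_frame (H (clamp t)) th).
pose h t th := (complex.Re (D t th), complex.Im (D t th)).
have [cRe cIm] := pole_frame_continuous sH.
have rot0 : rotates l (H 0) (k * 2) by rewrite H0; exact: rotates_zpow.
have rot1 : rotates l (H 1) (m * 2) by rewrite H1; exact: rotates_zpow.
have D0 t th : D t th != 0.
  by apply: pole_frame_det_neq0; [exact/Hxi/clamp01|exact: pole_factor_gt0 rot0 Hxi t th].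
have hw := @same_winding_homotopy R h cRe cIm.
have {hw} : same_winding (h 0) (h 1).
  apply: hw.
  - by move=> t th; rewrite /h /D pole_frame_periodic.
  - move=> t th [re im]; move: (D0 t th); rewrite (_ : D t th = 0) ?eqxx//.
    by move: re im; case: (D t th) => a b /= -> ->.
have sm0 : smooth_map (H 0) by have := smH 0; rewrite clamp_id// lexx ler01.
have sm1 : smooth_map (H 1) by have := smH 1; rewrite clamp_id// lexx ler01.
have [K K0 KE] := det_pole_frame_rotates sm0 rot0.
have [L L0 LE] := det_pole_frame_rotates sm1 rot1.
have -> : h 0 = fun x => (K * cos ((k * 2)%:~R * x), K * sin ((k * 2)%:~R * x)).
  by apply/funext => x; rewrite /h /D clamp_id ?lexx ?ler01// KE.
have -> : h 1 = fun x => (L * cos ((m * 2)%:~R * x), L * sin ((m * 2)%:~R * x)).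
  by apply/funext => x; rewrite /h /D clamp_id ?lexx ?ler01// LE.
by move=> /(winding_circle K0 L0)/mulIf; apply.
Qed.

End InfiniteOrder.

Theorem corollary2 (R : realType) (n : nat) (hn : (0 < n)%N) :
  exists Psi_c : V R n -> V R n,
    [/\ Diff_xi Psi_c,
        isotopic Diff (@Psi R n) Psi_c,
        infinite_cyclic Diff_xi (Psi_c \o Psi_c) &
        pi0_cycle Diff_xi (Psi_c \o Psi_c) `<=` ker_pi0_incl].
Proof.
(* Indices start at 0, so [z_n] is the coordinate of index [n.-1]. *)
have hl1 : (n.-1 < n)%N by rewrite prednK.
pose l := Ordinal hl1; have hl : l.+1 = n by rewrite /= prednK.
exists (@Phi R n l); rewrite -/(@Phi2 R n l); split.
- exact: Diff_xi_Phi.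
- exact: isotopic_Psi_Phi.
- move=> k m km; apply: (isotopic_zpow_inj hl).
  (* Equality of classes is evaluated at the [m]-th power, a member of its own class. *)
  have : pi0_zpow Diff_xi (@Phi2 R n l) m (zpow (@Phi2 R n l) m).
    have Dm := Diff_xi_zpow (R := R) hl m.
    exact: (isotopic_refl Dm Dm.1.1).
  by rewrite -km => kk; exact: kk.
- move=> _ [k _ <-]; have Dk := Diff_xi_zpow (R := R) hl k.
  split; first by exists (zpow (@Phi2 R n l) k).
  have ik := isotopic_zpow_id (R := R) hl k.
  (* Both inclusions pass through the smooth isotopy [ik] from the power to the identity;
     transitivity is used in [Diff] only. *)
  apply/seteqP; split=> g.
  + move=> [f kf fg]; apply: isotopic_trans fg.
    exact: isotopic_trans (isotopic_sym ik) (isotopic_xi_Diff kf).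
  + move=> ig; exists (zpow (@Phi2 R n l) k); last exact: isotopic_trans ik ig.
    exact: (isotopic_refl Dk Dk.1.1).
Qed.
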